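(* Let $\mathcal{H}$ be a complex Hilbert space, let $\{f_i\}_{i\in\mathbb{N}}$ be a frame for a closed subspace $\mathcal{S}\subseteq\mathcal{H}$ with synthesis operator $F:\ell^2\to\mathcal{H}$, and let $|F|=P_{F^*}-V$ be the projection proper splitting of $|F|$. If $P_{F^*}-|F|$ is a Hilbert-Schmidt operator and $\|P_{F^*}-|F|\|<1$, then the iterative process $$X^{i+1}=(P_{F^*}-|F|)X^i+F^*$$ converges (for every initial bounded operator $X^0:\mathcal{H}\to\ell^2$, in operator norm) to the adjoint of the synthesis operator of the symmetric approximation of $\{f_i\}_{i\in\mathbb{N}}$.
   Context: A sequence $\{f_i\}_{i\in\mathbb{N}}\subseteq\mathcal{S}$ is a frame for a closed subspace $\mathcal{S}$ if there are constants $A,B>0$ with $A\|x\|^2\leq\sum_{i}|\langle x,f_i\rangle|^2\leq B\|x\|^2$ for all $x\in\mathcal{S}$; it is normalized tight if $A=B=1$ is possible. Its synthesis operator is the bounded operator $F:\ell^2\to\mathcal{H}$ with $F(e_i)=f_i$, where $\{e_i\}$ is the standard orthonormal basis of $\ell^2$. $|F|=(F^*F)^{1/2}$, $P_{F^*}$ is the orthogonal projection of $\ell^2$ onto $\mathcal{R}(F^* )$, and $F=U_F|F|$ is the polar decomposition with $U_F$ the partial isometry with $\mathcal{N}(U_F)=\mathcal{N}(F)$. The projection proper splitting of $|F|$ is $|F|=P_{F^*}-V$, i.e. $V=P_{F^*}-|F|$. Two frames $\{f_i\}$, $\{g_i\}$ for subspaces $\mathcal{S}$, $\mathcal{T}$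 are weakly similar if there is a bounded invertible linear operator $L:\mathcal{S}\to\mathcal{T}$ with $Lf_i=g_i$ for all $i$. A normalized tight frame $\{v_i\}$ for a closed subspace $\mathcal{T}\subseteq\mathcal{H}$ is a symmetric approximation of $\{f_i\}$ if $\sum_i\|u_i-f_i\|^2\geq\sum_i\|v_i-f_i\|^2$ for all normalized tight frames $\{u_i\}$ weakly similar to $\{f_i\}$, and the right-hand sum is finite. It is known (Frank, Paulsen, Tiballi) that if $P_{F^*}-|F|$ is Hilbert-Schmidt then a symmetric approximation of $\{f_i\}$ exists and is given by $\{U_Fe_i\}_{i\in\mathbb{N}}$, whose synthesis operator is $U_F$; this is ''the symmetric approximation'' in the statement. *)

(* Defs.v *)
From HB Require Import structures.
From mathcomp Require Import all_boot all_order all_algebra.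
From mathcomp Require Import complex ring lra.
From mathcomp Require Import all_classical all_reals all_analysis.

Set Implicit Arguments.
Unset Strict Implicit.
Unset Printing Implicit Defensive.

Import Order.TTheory GRing.Theory Num.Theory Num.Def.
Import numFieldNormedType.Exports.

Local Open Scope classical_set_scope.
Local Open Scope ring_scope.
Local Open Scope complex_scope.

(* Norms over R[i] take values in R[i]; nrm is the same norm with values in R. *)
Definition nrm (R : realType) (V : normedZmodType R[i]) (x : V) : R :=
  complex.Re `|x|.

Section nrm.
Context (R : realType) (V : normedZmodType R[i]).
Implicit Types x y : V.

Lemma nrmE x : `|x| = (nrm x)%:C.
Proof. by apply/esym/RRe_real; exact: normr_real. Qed.

Lemma nrm_ge0 x : 0 <= nrm x.
Proof. by rewrite -lecR -nrmE; exact: normr_ge0. Qed.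

Lemma nrmD x y : nrm (x + y) <= nrm x + nrm y.
Proof. by rewrite -lecR rmorphD/= -!nrmE ler_normD. Qed.

Lemma nrmN x : nrm (- x) = nrm x.
Proof. by rewrite /nrm normrN. Qed.

Lemma nrm0_eq0 x : nrm x = 0 -> x = 0.
Proof. by move=> x0; apply/normr0_eq0; rewrite nrmE x0. Qed.

Lemma nrm0 : nrm (0 : V) = 0.
Proof. by rewrite /nrm normr0. Qed.

End nrm.

Section nrm_complex.
Context (R : realType).
Local Notation C := R[i].
Implicit Types (z w : C).

Lemma nrmM z w : nrm (z * w) = nrm z * nrm w.
Proof. by apply: (@complexI R); rewrite rmorphM/= -!nrmE normrM. Qed.

Lemma nrm_conj z : nrm (conjC z) = nrm z.
Proof. by case: z => a b; rewrite /nrm !normc_def/= sqrrN. Qed.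

Lemma nrm_sqr z : nrm z ^+ 2 = complex.Re z ^+ 2 + complex.Im z ^+ 2.
Proof. by apply: (@complexI R); rewrite rmorphXn/= -nrmE add_Re2_Im2. Qed.

Lemma mul_conj z : z * conjC z = (nrm z ^+ 2)%:C.
Proof. by rewrite -normCK nrmE rmorphXn. Qed.

Lemma Re_le_nrm z : `|complex.Re z| <= nrm z.
Proof. by rewrite -lecR -nrmE normc_ge_Re. Qed.

Lemma Im_le_nrm z : `|complex.Im z| <= nrm z.
Proof.
by rewrite -(ler_pXn2r (_ : 0 < 2)%N) ?nnegrE ?nrm_ge0// nrm_sqr real_normK ?num_real// lerDr sqr_ge0.
Qed.

Lemma nrm_le_ReIm z : nrm z <= `|complex.Re z| + `|complex.Im z|.
Proof.
rewrite -(ler_pXn2r (_ : 0 < 2)%N) ?nnegrE ?nrm_ge0 ?addr_ge0// nrm_sqr.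
rewrite sqrrD !real_normK ?num_real// -addrA [leRHS]addrCA [leRHS]addrC -addrA.
by rewrite lerD2l lerDl mulrn_wge0 ?mulr_ge0.
Qed.

End nrm_complex.

Section l2_predicate.
Context (R : realType).
Local Notation C := R[i].
Implicit Types x y : nat -> C.

Definition l2_pred : {pred nat -> C} :=
  mem [set x | (\sum_(0 <= i <oo) (nrm (x i) ^+ 2)%:E < +oo)%E].

Lemma l2P x : x \in l2_pred <->
  exists M : R, forall n, \sum_(0 <= i < n) nrm (x i) ^+ 2 <= M.
Proof.
rewrite /l2_pred inE/=; split => [xoo|[M xM]].
  exists (fine (\sum_(0 <= i <oo) (nrm (x i) ^+ 2)%:E)) => n.
  rewrite -lee_fin fineK ?ge0_fin_numE//; last first.
    by apply: nneseries_ge0 => *; rewrite lee_fin sqr_ge0.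
  rewrite -sumEFin; apply: nneseries_lim_ge => i _ _.
  by rewrite lee_fin sqr_ge0.
apply: (@le_lt_trans _ _ M%:E); last by rewrite ltry.
apply: lime_le.
  by apply: is_cvg_nneseries => *; rewrite lee_fin sqr_ge0.
by apply: nearW => n; rewrite sumEFin lee_fin.
Qed.

Lemma l2_submod_closed : submod_closed l2_pred.
Proof.
split; first by apply/l2P; exists 0 => n; rewrite big1// => i _; rewrite nrm0 expr0n.
move=> a x y /l2P[M xM] /l2P[N yN]; apply/l2P.
exists ((2 * nrm a ^+ 2) * M + 2 * N) => n.
apply: (@le_trans _ _ (\sum_(0 <= i < n)
    ((2 * nrm a ^+ 2) * nrm (x i) ^+ 2 + 2 * nrm (y i) ^+ 2))).
  apply: ler_sum => i _; rewrite -mulrA -exprMn -nrmM.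
  apply: (@le_trans _ _ ((nrm (a * x i) + nrm (y i)) ^+ 2)).
    by rewrite ler_pXn2r// ?nnegrE ?addr_ge0 ?nrm_ge0// nrmD.
  rewrite -subr_ge0; set u := nrm _; set v := nrm _.
  by rewrite (_ : _ - _ = (u - v) ^+ 2) ?sqr_ge0//; ring.
rewrite big_split/= -!mulr_sumr lerD//.
  by apply: ler_wpM2l; [apply: mulr_ge0 => //; exact: sqr_ge0|exact: xM].
by apply: ler_wpM2l => //; exact: yN.
Qed.

HB.instance Definition _ := GRing.isSubmodClosed.Build C (nat -> C) l2_pred
  l2_submod_closed.

Record l2 : Type := L2 { l2_val :> nat -> C ; l2_valP : l2_val \in l2_pred }.

HB.instance Definition _ := [isSub for l2_val].
HB.instance Definition _ := [Choice of l2 by <:].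
HB.instance Definition _ := [SubChoice_isSubLmodule of l2 by <:].

End l2_predicate.

Section dot_norm.
Context (C : numClosedFieldType) (V : lmodType C) (form : {dot V for conjC}).
Local Notation "''[' u , v ]" := (form u v).
Local Notation "''[' u ]" := '[u, u].

Lemma dot_CauchySchwarz (u v : V) : `|'[u, v]| ^+ 2 <= '[u] * '[v].
Proof.
have [->|v0] := eqVneq v 0; first by rewrite [form u 0]linear0r normr0 expr0n/= mulr_ge0 ?dnorm_ge0.
have vgt0 : 0 < '[v] by rewrite dnorm_gt0.
pose a := '[u, v] / '[v].
have : 0 <= '[u - a *: v] by exact: dnorm_ge0.
have vr : conjC '[v] = '[v] by apply/CrealP/gtr0_real.
have ac : conjC a = conjC '[u, v] / '[v] by rewrite /a rmorphM/= fmorphV/= vr.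
have -> : '[u - a *: v] = '[u] - `|'[u, v]| ^+ 2 / '[v].
  have d : '[u, a *: v] = conjC '[u, v] / '[v] * '[u, v].
    by rewrite linearZr_LR -ac.
  have d' : conjC '[u, a *: v] = '[u, v] / '[v] * conjC '[u, v].
    by rewrite d rmorphM/= -ac conjCK.
  rewrite dnormB dnormZ /= d' d !normCK ac /a.
  by field; rewrite gt_eqF.
by rewrite subr_ge0 ler_pdivrMr.
Qed.

Lemma dot_triangle (u v : V) : sqrtC '[u + v] <= sqrtC '[u] + sqrtC '[v].
Proof.
have su w : 0 <= sqrtC '[w] by rewrite sqrtC_ge0 dnorm_ge0.
rewrite -ler_sqr ?nnegrE ?addr_ge0// sqrrD !sqrtCK dnormD.
rewrite [leRHS]addrAC lerD2l.
have -> : '[u, v] + conjC '[u, v] = 'Re '[u, v] *+ 2.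
  by rewrite ReE -mulr_natr divfK ?pnatr_eq0.
rewrite lerMn2r/=; apply: (le_trans (leif_Re_Creal _)).
by rewrite -ler_sqr ?nnegrE ?mulr_ge0// exprMn !sqrtCK dot_CauchySchwarz.
Qed.

End dot_norm.

Section complex_series.
Context (R : realType).
Local Notation C := R[i].
Implicit Types u v : nat -> C.

Lemma ReD (z w : C) : complex.Re (z + w) = complex.Re z + complex.Re w.
Proof. by case: z w => [? ?] [? ?]. Qed.

Lemma ImD (z w : C) : complex.Im (z + w) = complex.Im z + complex.Im w.
Proof. by case: z w => [? ?] [? ?]. Qed.

Lemma ReN (z : C) : complex.Re (- z) = - complex.Re z.
Proof. by case: z. Qed.

Lemma ImN (z : C) : complex.Im (- z) = - complex.Im z.
Proof. by case: z. Qed.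

Lemma ReM (z w : C) : complex.Re (z * w) =
  complex.Re z * complex.Re w - complex.Im z * complex.Im w.
Proof. by case: z w => [? ?] [? ?]. Qed.

Lemma ImM (z w : C) : complex.Im (z * w) =
  complex.Re z * complex.Im w + complex.Im z * complex.Re w.
Proof. by case: z w => [? ?] [? ?]. Qed.

Lemma ImJ (z : C) : complex.Im (conjC z) = - complex.Im z.
Proof. by case: z. Qed.

(* Sum of a complex series, defined componentwise because R[i] itself carries
   no canonical topology. *)
Definition csum u : C :=
  Complex (limn (series (fun i => complex.Re (u i))))
          (limn (series (fun i => complex.Im (u i)))).

Definition abs_summable u :=
  exists M : R, forall n, \sum_(0 <= i < n) nrm (u i) <= M.

Lemma abs_summable_cvg (f : nat -> R) u : (forall i, `|f i| <= nrm (u i)) ->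
  abs_summable u -> cvgn (series f).
Proof.
move=> fu [M uM]; apply: normed_cvg; apply: nondecreasing_is_cvgn.
  by apply: nondecreasing_series => i _ _; exact: normr_ge0.
exists M => _ [n _ <-]; apply: le_trans (uM n).
by rewrite /series/=; apply: ler_sum => i _; exact: fu.
Qed.

Lemma abs_summable_cvgRe u : abs_summable u ->
  cvgn (series (fun i => complex.Re (u i))).
Proof. by apply: abs_summable_cvg => i; exact: Re_le_nrm. Qed.

Lemma abs_summable_cvgIm u : abs_summable u ->
  cvgn (series (fun i => complex.Im (u i))).
Proof. by apply: abs_summable_cvg => i; exact: Im_le_nrm. Qed.

Lemma csumD u v : abs_summable u -> abs_summable v ->
  csum (fun i => u i + v i) = csum u + csum v.
Proof.
move=> su sv; rewrite /csum.
have LR := lim_seriesD (abs_summable_cvgRe su) (abs_summable_cvgRe sv).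
have LI := lim_seriesD (abs_summable_cvgIm su) (abs_summable_cvgIm sv).
rewrite -[RHS]/(Complex (_ + _) (_ + _)) -LR -LI.
by congr (Complex (limn (series _)) (limn (series _)));
  apply/funext => i; rewrite ?ReD ?ImD.
Qed.

Lemma csumZ (a : C) u : abs_summable u ->
  csum (fun i => a * u i) = a * csum u.
Proof.
move=> su; rewrite /csum.
have cR := abs_summable_cvgRe su; have cI := abs_summable_cvgIm su.
have zc k f (cf : cvgn (series f)) := @is_cvg_seriesZ R f k cf.
have {1}-> : (fun i => complex.Re (a * u i)) =
    complex.Re a *: (fun i => complex.Re (u i)) -
    complex.Im a *: (fun i => complex.Im (u i)).
  by apply/funext => i; rewrite ReM.
have -> : (fun i => complex.Im (a * u i)) =
    complex.Re a *: (fun i => complex.Im (u i)) +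
    complex.Im a *: (fun i => complex.Re (u i)).
  by apply/funext => i; rewrite ImM.
rewrite lim_seriesB ?lim_seriesD; [|exact: zc..].
rewrite !lim_seriesZ//.
by case: a {zc} => ? ?.
Qed.

Lemma csum_conj u : abs_summable u ->
  csum (fun i => conjC (u i)) = conjC (csum u).
Proof.
move=> su; rewrite /csum; have cI := abs_summable_cvgIm su.
have -> : (fun i => complex.Im (conjC (u i))) =
    - (fun i => complex.Im (u i)).
  by apply/funext => i; rewrite ImJ.
rewrite lim_seriesN//.
by congr (Complex (limn (series _)) _); apply/funext => i; case: (u i).
Qed.

Lemma csum_real (f : nat -> R) :
  csum (fun i => (f i)%:C) = (limn (series f))%:C.
Proof.
rewrite /csum; congr Complex; apply/cvg_lim => //.
rewrite (_ : series _ = cst 0); first exact: cvg_cst.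
by apply/funext => n; rewrite /series/= big1.
Qed.

End complex_series.

Section l2_dot.
Context (R : realType).
Local Notation C := R[i].
Local Notation l2 := (l2 R).
Implicit Types x y z : l2.

Definition l2_dot x y : C := csum (fun i => x i * conjC (y i)).

Lemma l2_dot_summable x y : abs_summable (fun i => x i * conjC (y i)).
Proof.
have /l2P[M xM] := l2_valP x; have /l2P[N yN] := l2_valP y.
exists (M + N) => n; apply: le_trans (lerD (xM n) (yN n)).
rewrite -big_split/=; apply: ler_sum => i _; rewrite nrmM nrm_conj.
by have := nrm_ge0 (x i); have := nrm_ge0 (y i); nra.
Qed.

Lemma l2_dot_hermitian x y : l2_dot x y = (-1) ^+ false * conjC (l2_dot y x).
Proof.
rewrite mul1r -csum_conj; last exact: l2_dot_summable.
by congr csum; apply/funext => i; rewrite rmorphM/= conjCK mulrC.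
Qed.

Lemma l2_dot_linear y : linear_for *%R (l2_dot^~ y).
Proof.
move=> a x z; rewrite /l2_dot -csumZ; last exact: l2_dot_summable.
rewrite -csumD; last 2 first.
- have [M xM] := l2_dot_summable x y; exists (nrm a * M) => n.
  under eq_bigr do rewrite nrmM.
  by rewrite -mulr_sumr ler_wpM2l ?nrm_ge0.
- exact: l2_dot_summable.
by congr csum; apply/funext => i; rewrite mulrA -mulrDl.
Qed.

Lemma l2_dot_bilinear : bilinear_for *%R (conjC \; *%R) l2_dot.
Proof.
split=> [y|x]; first exact: l2_dot_linear.
move=> a y z; rewrite l2_dot_hermitian mul1r l2_dot_linear rmorphD/= rmorphM/=.
by rewrite [in RHS]l2_dot_hermitian [l2_dot x z]l2_dot_hermitian !mul1r.
Qed.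

HB.instance Definition _ := bilinear_isBilinear.Build C l2 l2 C
  (GRing.Scale.Law.clone _ _ ( *%R ) _)
  (GRing.Scale.Law.clone _ _ (conjC \; *%R ) _) l2_dot l2_dot_bilinear.

HB.instance Definition _ :=
  isHermitianSesquilinear.Build C l2 false conjC l2_dot l2_dot_hermitian.

Lemma l2_dotxx x : l2_dot x x = (limn (series (fun i => nrm (x i) ^+ 2)))%:C.
Proof.
by rewrite -csum_real; congr csum; apply/funext => i; rewrite mul_conj.
Qed.

Lemma l2_sum_cvg x : cvgn (series (fun i => nrm (x i) ^+ 2)).
Proof.
apply: (abs_summable_cvg _ (l2_dot_summable x x)) => i.
by rewrite nrmM nrm_conj ger0_norm ?sqr_ge0.
Qed.

Lemma l2_sum_le x n :
  \sum_(0 <= i < n) nrm (x i) ^+ 2 <= limn (series (fun i => nrm (x i) ^+ 2)).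
Proof.
apply: nondecreasing_cvgn_le; last exact: l2_sum_cvg.
by apply: nondecreasing_series => i _ _; exact: sqr_ge0.
Qed.

Lemma l2_dot_gt0 x : x != 0 -> 0 < l2_dot x x.
Proof.
move=> x0; rewrite l2_dotxx ltcR lt_neqAle; apply/andP; split; last first.
  by have := l2_sum_le x 0; rewrite big_nil.
apply: contra x0 => /eqP s0; apply/eqP/val_inj/funext => k /=.
apply/nrm0_eq0/eqP; rewrite -sqrf_eq0 eq_le sqr_ge0 andbT.
have := l2_sum_le x k.+1; rewrite -s0 big_nat_recr//=; apply: le_trans.
by rewrite lerDr sumr_ge0// => i _; exact: sqr_ge0.
Qed.

HB.instance Definition _ := isDotProduct.Build C l2 l2_dot l2_dot_gt0.

Definition l2_norm x : C := sqrtC (l2_dot x x).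

Lemma l2_normD x y : l2_norm (x + y) <= l2_norm x + l2_norm y.
Proof. exact: (dot_triangle (l2_dot : {dot l2 for conjC})). Qed.

Lemma l2_normZ (a : C) x : l2_norm (a *: x) = `|a| * l2_norm x.
Proof.
rewrite /l2_norm (dnormZ (l2_dot : {dot l2 for conjC})).
by rewrite sqrtCM ?nnegrE ?exprn_ge0 ?(dnorm_ge0 (l2_dot : {dot l2 for conjC}))// sqrCK.
Qed.

Lemma l2_norm0_eq0 x : l2_norm x = 0 -> x = 0.
Proof.
move/eqP; rewrite sqrtC_eq0 => /eqP xx0.
by apply/eqP; apply: contraT => /l2_dot_gt0; rewrite xx0 ltxx.
Qed.

HB.instance Definition _ :=
  Lmodule_isNormed.Build C l2 l2_normD l2_normZ l2_norm0_eq0.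

End l2_dot.

Section l2_complete.
Context (R : realType).
Local Notation C := R[i].
Local Notation l2 := (l2 R).
Implicit Types x y : l2.

Lemma l2_nrm_sqr x : nrm x ^+ 2 = limn (series (fun i => nrm (x i) ^+ 2)).
Proof.
apply: (@complexI R); rewrite -l2_dotxx rmorphXn/= -nrmE.
by rewrite -[LHS]/(sqrtC (l2_dot x x) ^+ 2) sqrtCK.
Qed.

Lemma l2_nrm_le x (M : R) : 0 <= M ->
  (forall n, \sum_(0 <= i < n) nrm (x i) ^+ 2 <= M ^+ 2) -> nrm x <= M.
Proof.
move=> M0 xM; rewrite -(ler_pXn2r (_ : 0 < 2)%N) ?nnegrE ?nrm_ge0//.
rewrite l2_nrm_sqr; apply: limr_le; first exact: l2_sum_cvg.
exact: nearW.
Qed.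

Lemma l2_sum_le_nrm x n : \sum_(0 <= i < n) nrm (x i) ^+ 2 <= nrm x ^+ 2.
Proof. by rewrite l2_nrm_sqr l2_sum_le. Qed.

Lemma l2_coord_le x i : nrm (x i) <= nrm x.
Proof.
rewrite -(ler_pXn2r (_ : 0 < 2)%N) ?nnegrE ?nrm_ge0//.
apply: le_trans (l2_sum_le_nrm x i.+1); rewrite big_nat_recr//= lerDr.
by apply: sumr_ge0 => k _; exact: sqr_ge0.
Qed.

Lemma l2_complete (F : set_system l2) : ProperFilter F -> cauchy F -> cvg F.
Proof.
move=> FF /cauchy_ballP cF.
have {}cF (e : R) : 0 < e -> exists2 P : set l2, F P &
    forall x y, P x -> P y -> nrm (x - y) < e.
  move=> e0; have e0' : 0 < e%:C by rewrite ltcR.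
  have [[P Q]/= [FP FQ] PQ] := cF _ e0'.
  exists (P `&` Q); first exact: filterI.
  move=> x y [Px _] [_ Qy].
  by have := PQ (x, y) (conj Px Qy); rewrite -ball_normE/= nrmE ltcR.
have cvgR (g : l2 -> R) : (forall x y, `|g x - g y| <= nrm (x - y)) ->
    cvg (g @ F).
  move=> gxy; apply: cauchy_cvg; apply/cauchy_ballP => e e0.
  have [P FP PP] := cF _ e0.
  have gP : F (g @^-1` (g @` P)) by apply: filterS FP => x Px; exists x.
  exists (g @` P, g @` P); first by split.
  move=> [_ _] /= [[x Px <-] [y Py <-]]; rewrite -ball_normE/=.
  by apply: le_lt_trans (gxy _ _) _; exact: PP.
have cRe i : cvg ((fun x : l2 => complex.Re (x i)) @ F).
  apply: cvgR => x y; apply: le_trans (l2_coord_le _ i).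
  by apply: le_trans (Re_le_nrm _); rewrite ReD ReN.
have cIm i : cvg ((fun x : l2 => complex.Im (x i)) @ F).
  apply: cvgR => x y; apply: le_trans (l2_coord_le _ i).
  by apply: le_trans (Im_le_nrm _); rewrite ImD ImN.
pose a i : C := Complex (lim ((fun x : l2 => complex.Re (x i)) @ F))
                        (lim ((fun x : l2 => complex.Im (x i)) @ F)).
have aF e : 0 < e -> exists2 P : set l2, F P &
    forall x, P x -> forall n, \sum_(0 <= i < n) nrm (x i - a i) ^+ 2 <= e ^+ 2.
  move=> e0; have [P FP PP] := cF _ e0; exists P => // x Px n.
  have gl : (fun y : l2 => \sum_(0 <= i < n)
      ((complex.Re (x i) - complex.Re (y i)) ^+ 2 +
       (complex.Im (x i) - complex.Im (y i)) ^+ 2)) @ F -->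
      \sum_(0 <= i < n) nrm (x i - a i) ^+ 2.
    apply: cvg_big => [|i _]; first exact: add_continuous.
    rewrite nrm_sqr ReD ReN ImD ImN.
    by apply: cvgD; apply: cvgM; (apply: cvgB; first exact: cvg_cst).
  rewrite -(cvg_lim _ gl)//; apply: limr_le; first by apply/cvg_ex; eexists; exact: gl.
  apply: filterS FP => y Py.
  apply: (@le_trans _ _ (nrm (x - y) ^+ 2)).
    apply: le_trans (l2_sum_le_nrm _ n); apply: ler_sum => i _.
    by rewrite nrm_sqr ReD ReN ImD ImN.
  by rewrite ler_pXn2r// ?nnegrE ?nrm_ge0 ?ltW// PP.
have a_l2 : a \in @l2_pred R.
  have [P FP aP] := aF 1 ltr01; have [x Px] := filter_ex FP.
  have xa : (l2_val x - a) \in @l2_pred R.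
    by apply/l2P; exists (1 ^+ 2) => n; exact: aP.
  by have := rpredB (l2_valP x) xa; rewrite opprB addrC subrK.
apply/cvg_ex; exists (L2 a_l2); apply/cvgrPdist_le => e e0.
have eE : e = (complex.Re e)%:C by apply/esym/RRe_real/gtr0_real.
have e'0 : 0 < complex.Re e by rewrite -ltcR -eE.
have [P FP aP] := aF _ e'0; apply: filterS FP => x Px.
rewrite nrmE eE lecR -nrmN opprB; apply: l2_nrm_le; first exact: ltW.
exact: aP.
Qed.

HB.instance Definition _ := Uniform_isComplete.Build l2 l2_complete.

End l2_complete.

#[key="H"]
HB.mixin Record isHilbert (R : realType) H & CompleteNormedModule R[i] H := {
  hdot : {dot H for (@conjC R[i])} ;
  hdotE : forall x : H, hdot x x = `|x| ^+ 2
}.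

#[short(type="hilbertType")]
HB.structure Definition Hilbert (R : realType) :=
  {H of CompleteNormedModule R[i] H & isHilbert R H}.

Section l2_hilbert.
Context (R : realType).
Lemma l2_hdotE (x : l2 R) : l2_dot x x = `|x| ^+ 2.
Proof. by rewrite -[`|x|]/(sqrtC (l2_dot x x)) sqrtCK. Qed.

HB.instance Definition _ := isHilbert.Build R (l2 R) l2_hdotE.

End l2_hilbert.

Arguments hdot {R s}.

Notation "''[' x , y ]" := (hdot x y) : ring_scope.

Section l2_basis.
Context (R : realType).

Lemma l2_basis_subproof (i : nat) :
  (fun j => (i == j)%:R : R[i]) \in @l2_pred R.
Proof.
apply/l2P; exists 1 => n; rewrite big_mkord.
have [ni|ni] := leqP n i.
  rewrite big1 ?ler01// => j _.
  by rewrite gtn_eqF ?(leq_trans (ltn_ord j))// nrm0 expr0n.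
rewrite (bigD1 (Ordinal ni))//= eqxx big1 ?addr0.
  by rewrite /nrm normr1 expr1n.
by move=> j /negPf; rewrite eq_sym -val_eqE/= => ->; rewrite nrm0 expr0n.
Qed.

Definition l2_basis (i : nat) : l2 R := L2 (l2_basis_subproof i).

End l2_basis.

Section operators.
Context (R : realType).
Implicit Types E G H : hilbertType R.

Definition opnorm E G (T : E -> G) : \bar R :=
  ereal_sup [set (nrm (T x))%:E | x in [set x | nrm x <= 1]].

Definition bounded_op E G (T : E -> G) : Prop := (opnorm T < +oo)%E.

Definition is_adjoint E G (T : E -> G) (Ts : G -> E) : Prop :=
  forall x y, '[T x, y] = '[x, Ts y].

(* 0 <= z in R[i] says that z is real and nonnegative. *)
Definition positive_op E (A : E -> E) : Prop := forall x, 0 <= '[A x, x].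

(* A = (T^* T)^(1/2), where Ts = T^*. *)
Definition is_absop E G (T : E -> G) (Ts : G -> E) (A : E -> E) : Prop :=
  [/\ bounded_op A, positive_op A & forall x, A (A x) = Ts (T x)].

Definition is_orthoproj E (M : set E) (P : E -> E) : Prop :=
  forall x, M (P x) /\ forall y, M y -> '[x - P x, y] = 0.

Definition kernel E G (T : E -> G) : set E := [set x | T x = 0].

Definition partial_isometry E G (U : E -> G) : Prop :=
  forall x, (forall y, kernel U y -> '[x, y] = 0) -> nrm (U x) = nrm x.

(* T = U A is the polar decomposition of T, where A = |T|. *)
Definition is_polar E G (T : E -> G) (A : E -> E) (U : E -> G) : Prop :=
  [/\ partial_isometry U, kernel U = kernel T & forall x, T x = U (A x)].

(* The sum over the standard basis; it is the same over any orthonormal basis. *)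
Definition hilbert_schmidt G (T : l2 R -> G) : Prop :=
  (\sum_(0 <= i <oo) (nrm (T (l2_basis R i)) ^+ 2)%:E < +oo)%E.

End operators.

Section frames.
Context (R : realType) (H : hilbertType R).
Implicit Types (S T : set H) (f g u v : nat -> H).

Definition closed_subspace S : Prop :=
  [/\ S 0, forall (a : R[i]) x y, S x -> S y -> S (a *: x + y) & closed S].

Definition frame_bounds S f (A B : R) : Prop :=
  (forall i, S (f i)) /\
  forall x, S x ->
    ((A * nrm x ^+ 2)%:E <= \sum_(0 <= i <oo) (nrm '[x, f i] ^+ 2)%:E
       <= (B * nrm x ^+ 2)%:E)%E.

Definition frame S f : Prop :=
  exists A B : R, [/\ 0 < A, 0 < B & frame_bounds S f A B].

Definition normalized_tight_frame S f : Prop := frame_bounds S f 1 1.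

Definition is_synthesis f (F : {linear l2 R -> H}) : Prop :=
  bounded_op F /\ forall i, F (l2_basis R i) = f i.

Definition bounded_linear_on S (L : H -> H) : Prop :=
  (forall (a : R[i]) x y, S x -> S y -> L (a *: x + y) = a *: L x + L y) /\
  exists c : R, forall x, S x -> nrm (L x) <= c * nrm x.

(* A map S -> T is represented by a function on H of which only the values on S
   matter; M is the inverse of L. *)
Definition weakly_similar S f T g : Prop :=
  exists L M : H -> H,
    [/\ bounded_linear_on S L /\ bounded_linear_on T M,
        forall x, S x -> T (L x) /\ M (L x) = x,
        forall y, T y -> S (M y) /\ L (M y) = y
      & forall i, L (f i) = g i].

Definition sqdist u f : \bar R :=
  (\sum_(0 <= i <oo) (nrm (u i - f i) ^+ 2)%:E)%E.

Definition symmetric_approximation S f v : Prop :=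
  [/\ exists2 T, closed_subspace T & normalized_tight_frame T v,
      forall T u, closed_subspace T -> normalized_tight_frame T u ->
        weakly_similar S f T u -> (sqdist v f <= sqdist u f)%E
    & (sqdist v f < +oo)%E].

End frames.

(* Main.v *)
(* Let B = P - |F|, a contraction commuting with P. The equation w = B w + P z
   has a unique solution w = G z, and |F| G = P, so U = F G is the partial
   isometry of the polar decomposition and U^* = G F^* is the fixed point of
   X |-> B X + F^*, to which the iteration converges geometrically.

   A normalized tight frame weakly similar to f has a synthesis operator W with
   W^* W = P = U^* U. With Y = W - U, W - F = Y + U B and, in Hilbert-Schmidt
   norm, |W - F|^2 - |U - F|^2 = |Y|^2 + 2 Re tr(B U^* Y). As
   U^* Y + Y^* U = - Y^* Y, this is |Y|^2 - tr(B Y^* Y), which is nonnegative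
   because B is a self-adjoint contraction. *)
Require Import Defs.
From HB Require Import structures.
From mathcomp Require Import all_boot all_order all_algebra.
From mathcomp Require Import complex ring lra.
From mathcomp Require Import all_classical all_reals all_analysis.

Set Implicit Arguments.
Unset Strict Implicit.
Unset Printing Implicit Defensive.

Import Order.TTheory GRing.Theory Num.Theory Num.Def.
Import numFieldNormedType.Exports.

Local Open Scope classical_set_scope.
Local Open Scope ring_scope.

(** * Inner product calculus and polarization *)

Section inner_product.
Context (R : realType) (E : hilbertType R).
Local Open Scope complex_scope.
Implicit Types x y z : E.

Lemma hdotDl x y z : '[x + y, z] = '[x, z] + '[y, z].
Proof. exact: (linearDl (hdot : {dot E for conjC})). Qed.

Lemma hdotDr x y z : '[z, x + y] = '[z, x] + '[z, y].
Proof. exact: (linearDr (hdot : {dot E for conjC})). Qed.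

Lemma hdotNl x z : '[- x, z] = - '[x, z].
Proof. exact: (linearNl (hdot : {dot E for conjC})). Qed.

Lemma hdotNr x z : '[z, - x] = - '[z, x].
Proof. exact: (linearNr (hdot : {dot E for conjC})). Qed.

Lemma hdotZl a x z : '[a *: x, z] = a * '[x, z].
Proof. exact: (linearZl_LR (hdot : {dot E for conjC})). Qed.

Lemma hdotZr a x z : '[z, a *: x] = conjC a * '[z, x].
Proof. exact: (linearZr_LR (hdot : {dot E for conjC})). Qed.

Lemma hdot0l z : '[0, z] = 0.
Proof. exact: (linear0l (hdot : {dot E for conjC})). Qed.

Lemma hdotC x y : '[x, y] = conjC '[y, x].
Proof. by rewrite (hermC (hdot : {dot E for conjC})) expr0 mul1r. Qed.

Lemma hdotBl x y z : '[x - y, z] = '[x, z] - '[y, z].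
Proof. by rewrite hdotDl hdotNl. Qed.

Lemma hdotBr x y z : '[z, x - y] = '[z, x] - '[z, y].
Proof. by rewrite hdotDr hdotNr. Qed.

Lemma hdotxx x : '[x, x] = (nrm x ^+ 2)%:C.
Proof. by rewrite hdotE nrmE rmorphXn. Qed.

Lemma Re_hdotC x y : complex.Re '[x, y] = complex.Re '[y, x].
Proof. by rewrite hdotC; case: ('[y, x]). Qed.

Lemma Re_hdotxx x : complex.Re '[x, x] = nrm x ^+ 2.
Proof. by rewrite hdotxx. Qed.

Lemma hdotxx_eq0 x : '[x, x] = 0 -> x = 0.
Proof.
rewrite hdotxx => /(congr1 (@complex.Re R))/= /eqP.
by rewrite sqrf_eq0 => /eqP/nrm0_eq0.
Qed.

Lemma nrm_sqrD x y :
  nrm (x + y) ^+ 2 = nrm x ^+ 2 + nrm y ^+ 2 + 2 * complex.Re '[x, y].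
Proof.
rewrite -!Re_hdotxx hdotDl !hdotDr !ReD [complex.Re '[y, x]]Re_hdotC; ring.
Qed.

Lemma nrm_sqrB x y :
  nrm (x - y) ^+ 2 = nrm x ^+ 2 + nrm y ^+ 2 - 2 * complex.Re '[x, y].
Proof. by rewrite nrm_sqrD nrmN hdotNr ReN mulrN. Qed.

Lemma nrm_hdot_le x y : nrm '[x, y] <= nrm x * nrm y.
Proof.
rewrite -(ler_pXn2r (_ : 0 < 2)%N) ?nnegrE ?mulr_ge0 ?nrm_ge0//.
rewrite -lecR rmorphXn/= -nrmE exprMn rmorphM/= -!hdotxx.
exact: (dot_CauchySchwarz (hdot : {dot E for conjC})).
Qed.

Lemma nrmZ (a : R[i]) x : nrm (a *: x) = nrm a * nrm x.
Proof. by apply: (@complexI R); rewrite rmorphM/= -!nrmE normrZ. Qed.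

Lemma Re_hdot_le x y : complex.Re '[x, y] <= nrm x * nrm y.
Proof. exact: le_trans (ler_norm _) (le_trans (Re_le_nrm _) (nrm_hdot_le x y)). Qed.

Lemma hdot_inj x y : (forall z, '[x, z] = '[y, z]) -> x = y.
Proof.
by move=> xy; apply/subr0_eq/hdotxx_eq0; rewrite hdotBl xy subrr.
Qed.

Lemma nrm_le_eq0 (x : E) : (forall e : R, 0 < e -> nrm x <= e) -> x = 0.
Proof.
move=> xe; apply/nrm0_eq0/eqP; rewrite eq_le nrm_ge0 andbT.
by apply/ler_addgt0Pr => e e0; rewrite add0r xe.
Qed.

(* Polarization over the complex numbers. *)
Lemma sesquilinear_eq0 (q : E -> E -> R[i]) :
  (forall x y z, q (x + y) z = q x z + q y z) ->
  (forall x y z, q z (x + y) = q z x + q z y) ->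
  (forall a x y, q (a *: x) y = a * q x y) ->
  (forall a x y, q x (a *: y) = conjC a * q x y) ->
  (forall x, q x x = 0) -> forall x y, q x y = 0.
Proof.
move=> qDl qDr qZl qZr q0 x y.
have D x' y' : q x' y' + q y' x' = 0.
  by have := q0 (x' + y'); rewrite qDl !qDr !q0 add0r addr0.
(* Replacing [y] by ['i *: y] flips the relative sign of the two terms, so [q] is symmetric as well
   as antisymmetric. *)
have := D x ('i *: y); rewrite qZl qZr conjCi mulNr addrC -mulrBr => /eqP.
have /negPf i0 : ('i : R[i]) != 0 by exact: neq0Ci.
rewrite mulf_eq0 i0/= => /eqP h.
have /eqP := D x y; rewrite (subr0_eq h) -mulr2n mulrn_eq0/= => /eqP; exact.
Qed.

End inner_product.

(** * Bounded operators, adjoints and positivity *)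

Section bounded_operators.
Context (R : realType).
Local Open Scope complex_scope.
Implicit Types E G : hilbertType R.

Definition bounded_by E G (T : E -> G) (c : R) :=
  forall x, nrm (T x) <= c * nrm x.

Lemma bounded_by_opnorm E G (T : E -> G) (c : R) :
  0 <= c -> bounded_by T c -> (opnorm T <= c%:E)%E.
Proof.
move=> c0 Tc; apply: ge_ereal_sup => _ [x /= x1 <-].
by rewrite lee_fin (le_trans (Tc x))// ler_piMr.
Qed.

Lemma bounded_by_bounded_op E G (T : E -> G) (c : R) :
  0 <= c -> bounded_by T c -> bounded_op T.
Proof. by move=> c0 /(bounded_by_opnorm c0)/le_lt_trans; apply; rewrite ltry. Qed.

Lemma opnorm_ge0 E G (T : {linear E -> G}) : (0 <= opnorm T)%E.
Proof.
apply: le_ereal_sup_tmp; exists 0%E => //.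
by exists 0; rewrite /= ?linear0 nrm0.
Qed.

(** Rescaling to a unit vector turns the supremum over the unit ball into a bound on all of [E]. *)
Lemma opnorm_bounded_by E G (T : {linear E -> G}) :
  bounded_op T -> 0 <= fine (opnorm T) /\ bounded_by T (fine (opnorm T)).
Proof.
move=> Tb; have T0 := opnorm_ge0 T.
split; first exact: fine_ge0.
move=> x; have [->|x0] := eqVneq x 0; first by rewrite linear0 !nrm0 mulr0.
have nx : 0 < nrm x.
  by rewrite lt_neqAle nrm_ge0 andbT eq_sym; apply: contra_neq x0 => /nrm0_eq0.
have ni : nrm (((nrm x)^-1)%:C : R[i]) = (nrm x)^-1.
  by apply: (@complexI R); rewrite -nrmE ger0_norm// lecR invr_ge0 ltW.
rewrite -ler_pdivrMr// mulrC -ni -nrmZ -linearZ.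
rewrite -lee_fin fineK; last by rewrite ge0_fin_numE.
apply: le_ereal_sup_tmp; exists (nrm (T (((nrm x)^-1)%:C *: x)))%:E => //.
by exists (((nrm x)^-1)%:C *: x) => //=; rewrite nrmZ ni mulVf// gt_eqF.
Qed.

Lemma bounded_byP E G (T : {linear E -> G}) :
  bounded_op T -> exists2 c, 0 <= c & bounded_by T c.
Proof. by move=> /opnorm_bounded_by[]; exists (fine (opnorm T)). Qed.

Lemma bounded_by_comp E G (K : hilbertType R) (T : E -> G) (T' : G -> K) (c c' : R) :
  0 <= c' -> bounded_by T c -> bounded_by T' c' -> bounded_by (T' \o T) (c' * c).
Proof.
move=> c0 Tc Tc' x /=; apply: (le_trans (Tc' _)).
by rewrite -mulrA ler_wpM2l.
Qed.

Lemma bounded_by_iter E (T : E -> E) (c : R) n :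
  0 <= c -> bounded_by T c -> bounded_by (iter n T) (c ^+ n).
Proof.
move=> c0 Tc; elim: n => [|n IH] x; first by rewrite expr0 mul1r.
by rewrite iterS exprS -mulrA (le_trans (Tc _))// ler_wpM2l.
Qed.

(** The square of [nrm (Ts y)] is ['[T (Ts y), y]], at most [c * nrm (Ts y) * nrm y]; one factor
    [nrm (Ts y)] cancels. *)
Lemma bounded_adjoint E G (T : E -> G) (Ts : G -> E) (c : R) :
  0 <= c -> bounded_by T c -> is_adjoint T Ts -> bounded_by Ts c.
Proof.
move=> c0 Tc adj y.
have h : nrm (Ts y) * nrm (Ts y) <= nrm (Ts y) * (c * nrm y).
  rewrite -expr2 -Re_hdotxx -adj; apply: le_trans (Re_hdot_le _ _) _.
  by rewrite mulrA [_ * c]mulrC ler_wpM2r ?nrm_ge0.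
have := nrm_ge0 (Ts y); rewrite le_eqVlt => /orP[/eqP<-|n0].
  by rewrite mulr_ge0 ?nrm_ge0.
by rewrite -(ler_pM2l n0).
Qed.

Lemma adjointC E G (T : E -> G) (Ts : G -> E) :
  is_adjoint T Ts -> is_adjoint Ts T.
Proof. by move=> adj x y; rewrite hdotC -adj -hdotC. Qed.

(** The inner product separates vectors, so having an adjoint forces linearity; this serves for maps
    obtained by choice. *)
Lemma adjoint_linear E G (T : E -> G) (Ts : G -> E) :
  is_adjoint T Ts -> linear T.
Proof.
move=> adj a x y; apply: hdot_inj => z.
by rewrite hdotDl hdotZl !adj hdotDl hdotZl.
Qed.

Lemma adjoint_comp E G (K : hilbertType R) (T : E -> G) (Ts : G -> E) (T' : G -> K) (Ts' : K -> G) :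
  is_adjoint T Ts -> is_adjoint T' Ts' -> is_adjoint (T' \o T) (Ts \o Ts').
Proof. by move=> a a' x y /=; rewrite a' a. Qed.

(** As ['[A x, x]] is real, the form ['[A x, y] - '[x, A y]] vanishes on the diagonal and
    polarization applies. *)
Lemma positive_selfadjoint E (A : {linear E -> E}) :
  positive_op A -> is_adjoint A A.
Proof.
move=> A0 x y; apply/subr0_eq.
apply: (@sesquilinear_eq0 R E (fun x y => '[A x, y] - '[x, A y])) => {x y}.
- by move=> x y z /=; rewrite [A (x + y)]linearD !hdotDl opprD addrACA.
- by move=> x y z /=; rewrite [A (x + y)]linearD !hdotDr opprD addrACA.
- by move=> a x y /=; rewrite [A (a *: _)]linearZ/= !hdotZl mulrBr.
- by move=> a x y /=; rewrite [A (a *: _)]linearZ/= !hdotZr mulrBr.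
move=> x; rewrite [in X in _ - X]hdotC.
by have /CrealP -> := ger0_real (A0 x); rewrite subrr.
Qed.

Definition mklinear E G (T : E -> G) (Tl : linear T) : {linear E -> G} :=
  HB.pack T (GRing.isLinear.Build _ _ _ _ T Tl).

Lemma quadratic_form_eq0 E (A : E -> E) : linear A ->
  (forall x, '[A x, x] = 0) -> forall x, A x = 0.
Proof.
move=> Al A0 x; pose A' := mklinear Al.
apply: hdot_inj => y; rewrite hdot0l.
apply: (@sesquilinear_eq0 R E (fun x y => '[A' x, y])) => {x y}//.
- by move=> x y z; rewrite linearD !hdotDl.
- by move=> x y z /=; rewrite hdotDr.
- by move=> a x y; rewrite linearZ/= !hdotZl.
- by move=> a x y /=; rewrite hdotZr.
Qed.

End bounded_operators.

(** * Norm convergence and contractions *)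

Section norm_limits.
Context (R : realType).
Local Open Scope complex_scope.
Implicit Types E G : hilbertType R.

(** Radii are real here, whereas the topology of a normed module over [R[i]] takes them in
    [R[i]]. *)
Definition nrm_cvg E (s : nat -> E) (w : E) :=
  forall e : R, 0 < e -> exists N, forall n, (N <= n)%N -> nrm (w - s n) < e.

Lemma cauchy_nrm_cvg E (s : nat -> E) :
  (forall e : R, 0 < e -> exists N, forall m n,
    (N <= m)%N -> (N <= n)%N -> nrm (s m - s n) < e) ->
  exists w, nrm_cvg s w.
Proof.
move=> sc; have cs : cvgn s.
  apply: cauchy_cvg; apply/cauchy_ballP => e e0.
  have eE : e = (complex.Re e)%:C by apply/esym/RRe_real/gtr0_real.
  have e'0 : 0 < complex.Re e by rewrite -ltcR -eE.
  have [N sN] := sc _ e'0.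
  exists ([set s n | n in [set n | (N <= n)%N]],
          [set s n | n in [set n | (N <= n)%N]]).
    by split; exists N => // n /= Nn; exists n.
  move=> [_ _] /= [[m Nm <-] [n Nn <-]].
  by rewrite -ball_normE/= nrmE eE ltcR sN.
have /cvg_ex[w /cvgrPdist_lt sw] := cs.
exists w => e e0; have e0' : 0 < e%:C :> R[i] by rewrite ltcR.
have [N _ Nw] := sw _ e0'.
by exists N => n Nn; have := Nw n Nn; rewrite nrmE ltcR.
Qed.

Lemma closed_nrm_cvg E (S : set E) (s : nat -> E) w :
  closed S -> (forall n, S (s n)) -> nrm_cvg s w -> S w.
Proof.
move=> Sc Ss sw; apply: Sc => B /nbhs_ballP[e /= e0 eB].
have eE : e = (complex.Re e)%:C by apply/esym/RRe_real/gtr0_real.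
have e'0 : 0 < complex.Re e by rewrite -ltcR -eE.
have [N sN] := sw _ e'0; exists (s N); split => //.
by apply: eB; rewrite -ball_normE/= nrmE eE ltcR sN.
Qed.

Lemma nrm_cvg_bounded E G (T : {linear E -> G}) (c : R) s w : 0 <= c ->
  bounded_by T c -> nrm_cvg s w -> nrm_cvg (T \o s) (T w).
Proof.
move=> c0 Tc sw e e0.
(* [c + 1] replaces [c] because [c] may be zero. *)
have [|N sN] := sw (e / (c + 1)); first by rewrite divr_gt0// ltr_wpDl.
exists N => n /sN; rewrite ltr_pdivlMr ?ltr_wpDl// => h.
rewrite /= -linearB; apply: le_lt_trans (Tc _) (le_lt_trans _ h).
by rewrite mulrC ler_wpM2l ?nrm_ge0// lerDl.
Qed.

Lemma nrm_cvg_unique E (s : nat -> E) w w' : nrm_cvg s w -> nrm_cvg s w' -> w = w'.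
Proof.
move=> sw sw'; apply/subr0_eq/nrm_le_eq0 => e e0.
have e2 : 0 < e / 2 by rewrite divr_gt0.
have [N sN] := sw _ e2; have [N' sN'] := sw' _ e2.
have := sN (maxn N N') (leq_maxl _ _); have := sN' (maxn N N') (leq_maxr _ _).
set x := s _ => h' h; rewrite (_ : w - w' = (w - x) - (w' - x)); last first.
  by rewrite opprB addrA subrK.
apply: le_trans (nrmD _ _) _; rewrite nrmN [leRHS]splitr.
by rewrite lerD// ltW.
Qed.

Lemma geometric_small (c K e : R) : 0 <= c < 1 -> 0 <= K -> 0 < e ->
  exists N, forall n, (N <= n)%N -> c ^+ n * K < e.
Proof.
move=> /andP[c0 c1] K0 e0.
have : c ^+ n @[n --> \oo] --> (0 : R) by apply: cvg_expr; rewrite ger0_norm.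
move=> /cvgrPdist_lt/(_ (e / (K + 1))) []; first by rewrite divr_gt0// ltr_wpDl.
move=> N _ cN; exists N => n /cN /=.
rewrite sub0r normrN ger0_norm ?exprn_ge0// ltr_pdivlMr ?ltr_wpDl//.
by apply: le_lt_trans; rewrite ler_wpM2l ?exprn_ge0// lerDl.
Qed.

(** Banach iteration from 0: the iterates form a Cauchy sequence, and its limit is the fixed
    point. *)
Lemma contraction_fixed_point E (T : {linear E -> E}) (c : R) (z : E) :
  0 <= c < 1 -> bounded_by T c -> exists w, w = T w + z.
Proof.
move=> /andP[c0 c1] Tc; pose s n := iter n (fun w => T w + z) 0.
(* [K] solves [K = c * K + nrm z], so [w |-> T w + z] preserves the ball of radius [K]. *)
pose K := nrm z / (1 - c).
have c1' : 0 < 1 - c by rewrite subr_gt0.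
have K0 : 0 <= K by rewrite divr_ge0 ?nrm_ge0// ltW.
have KE : K = c * K + nrm z.
  by rewrite /K; field; rewrite gt_eqF.
have sK n : nrm (s n) <= K.
  elim: n => [|n IH]; first by rewrite /s/= nrm0.
  rewrite /s iterS -/(s n) KE; apply: le_trans (nrmD _ _) _.
  by rewrite lerD2r (le_trans (Tc _))// ler_wpM2l.
have sB n k : nrm (s (n + k)%N - s n) <= c ^+ n * K.
  elim: n => [|n IH]; first by rewrite add0n subr0 mul1r.
  rewrite addSn /s !iterS -/(s n) -/(s (n + k)%N) opprD addrACA subrr addr0.
  by rewrite -linearB exprS -mulrA (le_trans (Tc _))// ler_wpM2l.
have [|w sw] := @cauchy_nrm_cvg E s.
  move=> e e0.
  (* Two indices beyond [N] are compared through [s N], which costs [c ^+ N * K] twice. *)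
  have [N cN] := geometric_small (introT andP (conj c0 c1)) (addr_ge0 K0 K0) e0.
  exists N => m n Nm Nn; apply: le_lt_trans (cN N (leqnn _)).
  rewrite (_ : s m - s n = (s m - s N) - (s n - s N)); last first.
    by rewrite opprB addrA subrK.
  apply: le_trans (nrmD _ _) _; rewrite nrmN mulrDr.
  by rewrite -[in s m](subnKC Nm) -[in s n](subnKC Nn) lerD.
(* The shifted sequence converges both to [w] and to [T w + z]. *)
exists w; apply: (@nrm_cvg_unique _ (fun n => s n.+1)).
  by move=> e /sw[N sN]; exists N => n Nn; apply: sN; exact: leqW.
move=> e /(nrm_cvg_bounded c0 Tc sw)[N sN]; exists N => n /sN /=.
by rewrite -/(s n) opprD addrACA subrr addr0.
Qed.

End norm_limits.

(** * Operators on [l2]: truncations, ranges and adjoints *)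

Section l2_operators.
Context (R : realType).
Local Open Scope complex_scope.
Local Notation l2 := (l2 R).
Local Notation e_ := (l2_basis R).
Implicit Types (x y : l2) (G : hilbertType R).

Definition l2_trunc x n : l2 := \sum_(i < n) x i *: e_ i.

Lemma l2_sumE (I : Type) (r : seq I) (y : I -> l2) k :
  (\sum_(i <- r) y i) k = \sum_(i <- r) y i k.
Proof. by elim/big_ind2: _ => // x1 u x2 v <- <-. Qed.

Lemma l2_sum_basisE (a : nat -> R[i]) n k :
  (\sum_(i < n) a i *: e_ i) k = if (k < n)%N then a k else 0.
Proof.
rewrite l2_sumE; case: ltnP => kn; last first.
  rewrite big1// => i _; rewrite -[LHS]/(a i * (i == k :> nat)%:R).
  by rewrite ltn_eqF ?mulr0// (leq_trans (ltn_ord i)).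
rewrite (bigD1 (Ordinal kn))//= big1 => [|i /negPf ik].
  by rewrite addr0 -[LHS]/(a k * (k == k)%:R) eqxx mulr1.
by rewrite -[LHS]/(a i * (i == k :> nat)%:R) -[k]/(val (Ordinal kn)) val_eqE ik mulr0.
Qed.

Lemma nrm_l2_sum_basis (a : nat -> R[i]) n :
  nrm (\sum_(i < n) a i *: e_ i) ^+ 2 = \sum_(i < n) nrm (a i) ^+ 2.
Proof.
rewrite l2_nrm_sqr; apply/cvg_lim => //; apply: cvg_near_cst.
exists n => // m /= nm; rewrite /series/= (big_cat_nat (n := n))//= [X in _ + X]big1_seq.
  rewrite addr0 big_mkord; apply: eq_bigr => i _.
  by rewrite l2_sum_basisE ltn_ord.
move=> i /=; rewrite mem_index_iota => /andP[ni _].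
by rewrite l2_sum_basisE ltnNge ni nrm0 expr0n.
Qed.

Lemma l2_trunc_cvg x : nrm_cvg (l2_trunc x) x.
Proof.
move=> e e0.
have e20 : 0 < (e / 2) ^+ 2 by rewrite exprn_gt0// divr_gt0.
have := @l2_sum_cvg R x => /cvg_ex[l xl].
have lE : l = nrm x ^+ 2 by rewrite l2_nrm_sqr; apply/esym/cvg_lim.
have /cvgrPdist_lt/(_ _ e20)[N _ xN] := xl.
exists N => n /xN; rewrite lE /series/= => h.
(* [l2_nrm_le] gives only a weak inequality, so the target is halved to keep the strict one. *)
apply: (@le_lt_trans _ _ (e / 2)); last by rewrite ltr_pdivrMr// ltr_pMr// ltr1n.
apply: l2_nrm_le => [|m]; first by rewrite ltW// divr_gt0.
apply: le_trans (ltW (le_lt_trans (ler_norm _) h)).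
(* Going up to [n + m] leaves room for both the head [i < n] and the part of the tail below [m]. *)
rewrite lerBrDl; apply: le_trans (l2_sum_le_nrm x (n + m)).
rewrite (big_cat_nat (n := n) (p := (n + m)%N))//= ?leq_addr// lerD2l.
have xE i : (x - l2_trunc x n) i = if (i < n)%N then 0 else x i.
  rewrite -[LHS]/(x i - l2_trunc x n i) l2_sum_basisE.
  by case: ifP; rewrite ?subrr ?subr0.
rewrite (eq_bigr (fun i => nrm (if (i < n)%N then 0 else x i) ^+ 2)); last first.
  by move=> i _; congr (nrm _ ^+ 2); exact: xE.
have [mn|nm] := leqP m n.
  rewrite big1_seq => [|i]; first by apply: sumr_ge0 => i _; exact: sqr_ge0.
  rewrite /= mem_index_iota => /andP[_ im].
  by rewrite (leq_trans im)//= nrm0 expr0n.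
rewrite (big_cat_nat (n := n))//= 1?ltnW// big1_seq ?add0r; last first.
  by move=> i /=; rewrite mem_index_iota => /andP[_ ->]; rewrite nrm0 expr0n.
rewrite [leRHS](big_cat_nat (n := m))//= ?leq_addl ?(ltnW nm)//.
rewrite -[leLHS]addr0 lerD//; last by apply: sumr_ge0 => i _; exact: sqr_ge0.
by apply: ler_sum_nat => i /andP[ni _]; rewrite ltnNge ni.
Qed.

(** Images of truncations are finite combinations of the [T (e_ i)], and [T x] is their norm
    limit. *)
Lemma closed_subspace_range G (S : set G) (T : {linear l2 -> G}) :
  closed_subspace S -> bounded_op T -> (forall i, S (T (e_ i))) ->
  forall x, S (T x).
Proof.
move=> [S0 Sl Sc] /bounded_byP[c c0 Tc] ST x.
apply: closed_nrm_cvg (nrm_cvg_bounded c0 Tc (l2_trunc_cvg x)) => // n.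
rewrite /= /l2_trunc linear_sum; elim/big_ind: _ => // [y z Sy Sz|i _].
  by have := Sl 1 y z Sy Sz; rewrite scale1r.
by rewrite linearZ/= -[_ *: _]addr0; exact: Sl.
Qed.

Lemma series_single (u : nat -> R) i :
  (forall k, k != i -> u k = 0) -> limn (series u) = u i.
Proof.
move=> u0; apply/cvg_lim => //; apply: cvg_near_cst; exists i.+1 => // n /= ni.
rewrite /series/= (bigD1_seq i) ?iota_uniq ?mem_index_iota//= big1_seq ?addr0//.
by move=> k /andP[/u0].
Qed.

Lemma hdot_basis x i : '[x, e_ i] = x i.
Proof.
rewrite -[LHS]/(csum (fun k => x k * conjC (i == k)%:R)) /csum.
rewrite !(@series_single _ i) ?eqxx ?rmorph1 ?mulr1; first by case: (x i).
all: by move=> k /negPf ki; rewrite eq_sym ki rmorph0 mulr0.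
Qed.

(** The adjoint is defined by coordinates, [Ts h] being the sequence of the ['[h, T (e_ i)]]. The
    adjoint identity holds on truncations and extends by continuity. *)
Lemma bounded_l2_adjoint G (T : {linear l2 -> G}) : bounded_op T ->
  exists Ts : G -> l2, is_adjoint T Ts.
Proof.
move=> /bounded_byP[c c0 Tc].
have Tl h : (fun i => '[h, T (e_ i)]) \in @l2_pred R.
  apply/l2P; exists ((c * nrm h) ^+ 2) => n; rewrite big_mkord.
  set a := fun i => '[h, T (e_ i)]; set s := \sum_(i < n) _.
  have s0 : 0 <= s by apply: sumr_ge0 => i _; exact: sqr_ge0.
  have hs : '[h, T (\sum_(i < n) a i *: e_ i)] = s%:C.
    rewrite /s rmorph_sum/= linear_sum hdotC; elim/big_ind2: _ => [|u z v w h1 h2|i _].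
    - by rewrite hdot0l rmorph0.
    - by rewrite hdotDl rmorphD/= h1 h2.
    by rewrite linearZ/= -hdotC hdotZr -/(a i) mulrC mul_conj.
  (* Testing [T] on the truncation of [a] itself, whose squared norm is [s], bounds [s] by
     [(c * nrm h) ^+ 2] for every [n]. *)
  have : s ^+ 2 <= (c * nrm h) ^+ 2 * s.
    rewrite /s -(nrm_l2_sum_basis a) -exprMn ler_pXn2r ?nnegrE ?sqr_ge0 ?mulr_ge0 ?nrm_ge0//.
    rewrite nrm_l2_sum_basis -/s -[s]/(complex.Re s%:C) -hs.
    apply: le_trans (Re_hdot_le _ _) _; rewrite -mulrA mulrCA ler_wpM2l ?nrm_ge0//.
  by move: s0; rewrite le_eqVlt => /orP[/eqP<-|s0]; rewrite ?sqr_ge0// expr2 ler_pM2r.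
exists (fun h => L2 (Tl h)) => x h; set y := L2 (Tl h).
have Te i : '[T (e_ i), h] = '[e_ i, y].
  by rewrite hdotC [RHS]hdotC hdot_basis.
have Tt n : '[T (l2_trunc x n), h] = '[l2_trunc x n, y].
  rewrite /l2_trunc linear_sum; elim/big_ind2: _ => [|u z v w h1 h2|i _].
  - by rewrite !hdot0l.
  - by rewrite !hdotDl h1 h2.
  by rewrite linearZ/= !hdotZl Te.
apply/subr0_eq/nrm0_eq0/eqP; rewrite eq_le nrm_ge0 andbT.
apply/ler_addgt0Pr => e e0; rewrite add0r.
(* [K] bounds the two functionals of [x] together; the added 1 makes it positive. *)
pose K := c * nrm h + nrm y + 1.
have K0 : 0 < K by rewrite ltr_wpDl// addr_ge0 ?mulr_ge0 ?nrm_ge0.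
have [N /(_ N (leqnn _)) xN] := l2_trunc_cvg x (divr_gt0 e0 K0).
set z := l2_trunc x N in xN.
have -> : '[T x, h] - '[x, y] = '[T (x - z), h] - '[x - z, y].
  by rewrite linearB !hdotBl Tt opprB addrA subrK.
apply: le_trans (nrmD _ _) _; rewrite nrmN.
apply: le_trans (lerD (nrm_hdot_le _ _) (nrm_hdot_le _ _)) _.
rewrite ltr_pdivlMr// in xN; apply: le_trans _ (ltW xN).
rewrite /K !mulrDr mulr1 -addrA mulrA lerD//.
  by rewrite ler_wpM2r ?nrm_ge0// mulrC Tc.
by rewrite lerDl nrm_ge0.
Qed.

End l2_operators.

(** * Bounded convex sequences *)

Section convex_sequences.
Context (R : realType).

(** Increments of a convex sequence are nondecreasing, so a positive first one would force linear
    growth past [M]. *)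
Lemma bounded_convex_le (a : nat -> R) (M : R) :
  (forall k, 2 * a k.+1 <= a k + a k.+2) -> (forall k, a k <= M) -> a 1%N <= a 0%N.
Proof.
move=> ac aM; rewrite leNgt; apply/negP => a01.
pose d := a 1%N - a 0%N; have d0 : 0 < d by rewrite subr_gt0.
have ad k : d <= a k.+1 - a k.
  by elim: k => // k IH; apply: le_trans IH _; have := ac k; lra.
have ak k : a 0%N + d *+ k <= a k.
  elim: k => [|k IH]; first by rewrite mulr0n addr0.
  by rewrite mulrSr; have := ad k; lra.
have Ma0 : 0 <= M - a 0%N by rewrite subr_ge0.
have := archi_boundP (divr_ge0 Ma0 (ltW d0)); set n := Num.bound _.
rewrite ltr_pdivrMr// mulr_natl => Md.
by have := le_trans (ak n) (aM n); lra.
Qed.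

End convex_sequences.

(** * Hilbert-Schmidt norm and inner product *)

Section hilbert_schmidt_operators.
Context (R : realType).
Local Open Scope complex_scope.
Local Notation l2 := (l2 R).
Local Notation e_ := (l2_basis R).
Implicit Types (G K : hilbertType R).

(** The squared Hilbert-Schmidt norm as a real limit, meaningful once the series converges. *)
Definition hs_sqr G (T : l2 -> G) : R :=
  limn (series (fun i => nrm (T (e_ i)) ^+ 2)).

(** The real part of the Hilbert-Schmidt inner product, [Re tr (Y^* X)]. *)
Definition hs_dot G (X Y : l2 -> G) : R :=
  limn (series (fun i => complex.Re '[X (e_ i), Y (e_ i)])).

Lemma hilbert_schmidtP G (T : l2 -> G) : hilbert_schmidt T <->
  exists M : R, forall n, \sum_(0 <= i < n) nrm (T (e_ i)) ^+ 2 <= M.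
Proof.
have nE i : nrm ((nrm (T (e_ i)))%:C : R[i]) = nrm (T (e_ i)).
  by rewrite {1}/nrm -nrmE normr_id nrmE.
(* The norms, seen as complex numbers, form a sequence to which the criterion [l2P] applies. *)
have := @l2P R (fun i => (nrm (T (e_ i)))%:C); rewrite inE/=.
rewrite (eq_eseriesr (g := fun i => (nrm (T (e_ i)) ^+ 2)%:E)); last first.
  by move=> i _; rewrite nE.
have sE n : \sum_(0 <= i < n) nrm ((nrm (T (e_ i)))%:C : R[i]) ^+ 2 =
    \sum_(0 <= i < n) nrm (T (e_ i)) ^+ 2 by apply: eq_bigr => i _; rewrite nE.
move=> h; apply: (iff_trans h); split=> -[M TM]; exists M => n.
  by rewrite -sE.
by rewrite sE.
Qed.

Lemma hs_sqr_cvg G (T : l2 -> G) : hilbert_schmidt T ->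
  cvgn (series (fun i => nrm (T (e_ i)) ^+ 2)).
Proof.
move=> /hilbert_schmidtP[M TM]; apply: nondecreasing_is_cvgn.
  by apply: nondecreasing_series => i _ _; exact: sqr_ge0.
by exists M => _ [n _ <-]; exact: TM.
Qed.

Lemma hs_sqr_ge0 G (T : l2 -> G) : hilbert_schmidt T -> 0 <= hs_sqr T.
Proof.
move=> /hs_sqr_cvg Tc; apply: limr_ge => //; apply: nearW => n.
by apply: sumr_ge0 => i _; exact: sqr_ge0.
Qed.

Lemma hs_sqrE G (T : l2 -> G) : hilbert_schmidt T ->
  (\sum_(0 <= i <oo) (nrm (T (e_ i)) ^+ 2)%:E = (hs_sqr T)%:E)%E.
Proof.
move=> /hs_sqr_cvg Tc; apply/cvg_lim => //.
under eq_fun do rewrite sumEFin.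
by apply: cvg_EFin; [exact: nearW|exact: Tc].
Qed.

Lemma hilbert_schmidtD G (X Y : l2 -> G) : hilbert_schmidt X ->
  hilbert_schmidt Y -> hilbert_schmidt (fun x => X x + Y x).
Proof.
move=> /hilbert_schmidtP[M XM] /hilbert_schmidtP[N YN]; apply/hilbert_schmidtP.
exists (2 * M + 2 * N) => n.
apply: le_trans (lerD (ler_wpM2l _ (XM n)) (ler_wpM2l _ (YN n))) => //.
rewrite !mulr_sumr -big_split/=; apply: ler_sum => i _.
by have := sqr_ge0 (nrm (X (e_ i) - Y (e_ i))); rewrite nrm_sqrB nrm_sqrD; lra.
Qed.

Lemma hilbert_schmidtN G (X : l2 -> G) : hilbert_schmidt X ->
  hilbert_schmidt (fun x => - X x).
Proof.
move=> /hilbert_schmidtP[M XM]; apply/hilbert_schmidtP; exists M => n.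
by under eq_bigr do rewrite nrmN.
Qed.

Lemma hilbert_schmidt_comp G K (X : l2 -> G) (B : G -> K) (c : R) :
  0 <= c -> bounded_by B c -> hilbert_schmidt X ->
  hilbert_schmidt (B \o X) /\ hs_sqr (B \o X) <= c ^+ 2 * hs_sqr X.
Proof.
move=> c0 Bc Xhs.
have h i : nrm ((B \o X) (e_ i)) ^+ 2 <= c ^+ 2 * nrm (X (e_ i)) ^+ 2.
  by rewrite -exprMn ler_pXn2r ?nnegrE ?mulr_ge0 ?nrm_ge0// Bc.
have BX : hilbert_schmidt (B \o X).
  have /hilbert_schmidtP[M XM] := Xhs; apply/hilbert_schmidtP.
  exists (c ^+ 2 * M) => n; apply: le_trans (ler_wpM2l (sqr_ge0 c) (XM n)).
  by rewrite mulr_sumr; apply: ler_sum => i _; exact: h.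
split=> //; have Xc := hs_sqr_cvg Xhs.
rewrite /hs_sqr -[_ * _]/(_ *: _) -lim_seriesZ//.
by apply: lim_series_le => //; [exact: hs_sqr_cvg|exact: is_cvg_seriesZ].
Qed.

(** By polarization the terms are combinations of three summable sequences of squares. *)
Lemma hs_dot_cvg G (X Y : l2 -> G) : hilbert_schmidt X -> hilbert_schmidt Y ->
  cvgn (series (fun i => complex.Re '[X (e_ i), Y (e_ i)])).
Proof.
move=> Xh Yh; have Sh := hilbert_schmidtD Xh Yh.
have -> : (fun i => complex.Re '[X (e_ i), Y (e_ i)]) =
    2^-1 *: ((fun i => nrm (X (e_ i) + Y (e_ i)) ^+ 2) -
      (fun i => nrm (X (e_ i)) ^+ 2) - (fun i => nrm (Y (e_ i)) ^+ 2)).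
  apply/funext => i; rewrite -[RHS]/(2^-1 * (_ - _ - _)) nrm_sqrD.
  by field.
apply: is_cvg_seriesZ; apply: is_cvg_seriesB; last exact: hs_sqr_cvg.
by apply: is_cvg_seriesB; [exact: (hs_sqr_cvg Sh)|exact: hs_sqr_cvg].
Qed.

Lemma hs_sqrD G (X Y : l2 -> G) : hilbert_schmidt X -> hilbert_schmidt Y ->
  hs_sqr (fun x => X x + Y x) = hs_sqr X + hs_sqr Y + 2 * hs_dot X Y.
Proof.
move=> Xh Yh; have Xc := hs_sqr_cvg Xh; have Yc := hs_sqr_cvg Yh.
have Dc := hs_dot_cvg Xh Yh; rewrite /hs_sqr /hs_dot -[2 * _]/(2 *: _).
rewrite -lim_seriesZ// -!lim_seriesD//; last 2 first.
- exact: is_cvg_seriesD.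
- exact: is_cvg_seriesZ.
by congr (limn (series _)); apply/funext => i; rewrite nrm_sqrD.
Qed.

Lemma hs_dotNr G (X Y : l2 -> G) : hilbert_schmidt X -> hilbert_schmidt Y ->
  hs_dot X (fun x => - Y x) = - hs_dot X Y.
Proof.
move=> Xh Yh; rewrite /hs_dot -lim_seriesN; last exact: hs_dot_cvg.
by congr (limn (series _)); apply/funext => i; rewrite hdotNr ReN.
Qed.

Lemma hs_dotDl G (X X' Y : l2 -> G) : hilbert_schmidt X -> hilbert_schmidt X' ->
  hilbert_schmidt Y -> hs_dot (fun x => X x + X' x) Y = hs_dot X Y + hs_dot X' Y.
Proof.
move=> Xh X'h Yh; rewrite /hs_dot -lim_seriesD; [|exact: hs_dot_cvg..].
by congr (limn (series _)); apply/funext => i; rewrite hdotDl ReD.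
Qed.

Lemma hs_sqrN G (X : l2 -> G) : hs_sqr (fun x => - X x) = hs_sqr X.
Proof.
by congr (limn (series _)); apply/funext => i; rewrite nrmN.
Qed.

Lemma hs_dot_le G (X Y : l2 -> G) : hilbert_schmidt X -> hilbert_schmidt Y ->
  2 * hs_dot X Y <= hs_sqr X + hs_sqr Y.
Proof.
move=> Xh Yh; have Nh := hilbert_schmidtN Yh.
have := hs_sqr_ge0 (hilbert_schmidtD Xh Nh).
by rewrite hs_sqrD// hs_sqrN hs_dotNr//; lra.
Qed.

Lemma nneseries_nrm_sqr (x : l2) :
  (\sum_(0 <= j <oo) (nrm (x j) ^+ 2)%:E = (nrm x ^+ 2)%:E)%E.
Proof.
rewrite l2_nrm_sqr; apply/cvg_lim => //; under eq_fun do rewrite sumEFin.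
by apply: cvg_EFin; [exact: nearW|exact: l2_sum_cvg].
Qed.

(** Both sides are the double sum of the squared moduli of ['[T (e_ i), e_ j]]; nonnegativity allows
    interchanging the sums. *)
Lemma hs_adjoint (T Ts : l2 -> l2) : is_adjoint T Ts ->
  (\sum_(0 <= i <oo) (nrm (T (e_ i)) ^+ 2)%:E =
   \sum_(0 <= i <oo) (nrm (Ts (e_ i)) ^+ 2)%:E)%E.
Proof.
move=> adj.
under eq_eseriesr do rewrite -nneseries_nrm_sqr.
rewrite nneseries_interchange; last by move=> i j; rewrite lee_fin sqr_ge0.
under [RHS]eq_eseriesr do rewrite -nneseries_nrm_sqr.
apply: eq_eseriesr => j _; apply: eq_eseriesr => i _.
by rewrite -!hdot_basis adj hdotC nrm_conj.
Qed.

Lemma hilbert_schmidt_adjoint (T Ts : l2 -> l2) : is_adjoint T Ts ->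
  hilbert_schmidt T -> hilbert_schmidt Ts /\ hs_sqr Ts = hs_sqr T.
Proof.
move=> adj Th; have Tsh : hilbert_schmidt Ts.
  by rewrite /hilbert_schmidt -(hs_adjoint adj).
by split=> //; apply: EFin_inj; rewrite -!hs_sqrE// (hs_adjoint adj).
Qed.

(* Polarization of the invariance of the Hilbert-Schmidt norm under adjoints. *)
Lemma hs_dot_adjoint (X Xs B : l2 -> l2) : is_adjoint X Xs -> is_adjoint B B ->
  hilbert_schmidt X -> hilbert_schmidt B -> hs_dot Xs B = hs_dot X B.
Proof.
move=> Xa Ba Xh Bh; have [Xsh XsE] := hilbert_schmidt_adjoint Xa Xh.
have Sa : is_adjoint (fun x => X x + B x) (fun x => Xs x + B x).
  by move=> x y; rewrite hdotDl hdotDr Xa Ba.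
have [_] := hilbert_schmidt_adjoint Sa (hilbert_schmidtD Xh Bh).
by rewrite !hs_sqrD// XsE; lra.
Qed.

(** [hs_sqr (Z \o B)] is [Re tr (B Z^* Z B)]. Moving one [B] across by [hs_dot_adjoint] turns it
    into [hs_dot Z (Z \o B \o B)], and [2ab <= a^2 + b^2] concludes. *)
Lemma hs_sqr_comp_convex G (Z : l2 -> G) (Zs : G -> l2) (B : l2 -> l2) (c b : R) :
  0 <= c -> bounded_by Z c -> is_adjoint Z Zs -> hilbert_schmidt Z ->
  0 <= b -> bounded_by B b -> is_adjoint B B -> hilbert_schmidt B ->
  2 * hs_sqr (Z \o B) <= hs_sqr Z + hs_sqr (Z \o B \o B).
Proof.
move=> c0 Zc Za Zh b0 Bb Ba Bh.
have Zsc := bounded_adjoint c0 Zc Za.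
have [Rh _] := hilbert_schmidt_comp c0 Zsc Zh.
have [BRh _] := hilbert_schmidt_comp b0 Bb Rh.
have [BBh _] := hilbert_schmidt_comp b0 Bb Bh.
have [ZBBh _] := hilbert_schmidt_comp c0 Zc BBh.
have Ra : is_adjoint (Zs \o Z) (Zs \o Z) := adjoint_comp Za (adjointC Za).
have BRa : is_adjoint (B \o (Zs \o Z)) ((Zs \o Z) \o B) := adjoint_comp Ra Ba.
suff -> : hs_sqr (Z \o B) = hs_dot Z (Z \o B \o B) by exact: hs_dot_le.
transitivity (hs_dot ((Zs \o Z) \o B) B).
  congr (limn (series _)); apply/funext => i.
  rewrite -[RHS]/(complex.Re '[Zs (Z (B (e_ i))), B (e_ i)]).
  by rewrite (adjointC Za) Re_hdotxx.
rewrite (hs_dot_adjoint BRa)//; congr (limn (series _)); apply/funext => i.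
rewrite -[LHS]/(complex.Re '[B (Zs (Z (e_ i))), B (e_ i)]).
by rewrite Ba (adjointC Za).
Qed.

(* The sequence [hs_sqr (Y \o B^k)] is convex and bounded, hence nonincreasing;
   this avoids computing in an orthonormal basis of G, which may not be
   separable. *)
Lemma hs_sqr_comp_le G (Y : l2 -> G) (Ys : G -> l2) (B : l2 -> l2) (c : R) :
  0 <= c -> bounded_by Y c -> is_adjoint Y Ys -> hilbert_schmidt Y ->
  bounded_by B 1 -> is_adjoint B B -> hilbert_schmidt B ->
  hs_sqr (Y \o B) <= hs_sqr Y.
Proof.
move=> c0 Yc Ya Yh B1 Ba Bh; pose Z k := Y \o iter k B.
have Zc k : bounded_by (Z k) c.
  by move=> x; have := bounded_by_comp c0 (bounded_by_iter k ler01 B1) Yc x;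
    rewrite expr1n mulr1.
have Za k : is_adjoint (Z k) (iter k B \o Ys).
  apply: adjoint_comp => //; elim: k => [|k IH] x y //.
  by rewrite iterS Ba IH -iterSr.
have ZS k : Z k.+1 = Z k \o B by apply/funext => x; rewrite /Z /= -iterSr.
have Zh k : hilbert_schmidt (Z k).
  by case: k => [//|k]; rewrite ZS; exact: (hilbert_schmidt_comp c0 (Zc k) Bh).1.
(* A bound uniform in [k]: the first summand serves [k = 0]; for [k > 0] one factor [B] is
   Hilbert-Schmidt and the rest is bounded by [c]. *)
have ZM k : hs_sqr (Z k) <= hs_sqr Y + c ^+ 2 * hs_sqr B.
  have cB : 0 <= c ^+ 2 * hs_sqr B by rewrite mulr_ge0 ?sqr_ge0 ?hs_sqr_ge0.
  case: k => [|k]; first by rewrite lerDl.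
  rewrite ZS; apply: le_trans (hilbert_schmidt_comp c0 (Zc k) Bh).2 _.
  by rewrite lerDr hs_sqr_ge0.
apply: (@bounded_convex_le R (fun k => hs_sqr (Z k)) _ _ ZM) => k.
by rewrite !ZS; exact: (hs_sqr_comp_convex c0 (Zc k) (Za k) (Zh k) ler01 B1 Ba Bh).
Qed.

End hilbert_schmidt_operators.

(** * Kernels, the projection [P] and the polar decomposition *)

Section polar_decomposition.
Context (R : realType) (H : hilbertType R).
Local Open Scope complex_scope.
Local Notation l2 := (l2 R).
Local Notation e_ := (l2_basis R).
Context (F : {linear l2 -> H}) (Fs : {linear H -> l2}) (A P : {linear l2 -> l2}).
Context (Fa : is_adjoint F Fs) (AF : is_absop F Fs A).
Context (PF : is_orthoproj (range Fs) P).

Lemma absop_selfadjoint : is_adjoint A A.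
Proof. by case: AF => _ /positive_selfadjoint. Qed.

Lemma hdot_absop x y : '[F x, F y] = '[A x, A y].
Proof. by case: AF => _ _ AA; rewrite Fa -AA absop_selfadjoint. Qed.

Lemma absop_eq0 x : A x = 0 <-> F x = 0.
Proof.
split=> h; apply: hdotxx_eq0; first by rewrite hdot_absop h hdot0l.
by rewrite -hdot_absop h hdot0l.
Qed.

(** The defect [x - P x] is orthogonal to the range of [Fs], and the orthogonal complement of that
    range is the kernel of [F]. *)
Lemma synthesis_sub_proj x : F (x - P x) = 0.
Proof.
by apply: hdot_inj => z; rewrite hdot0l Fa (PF x).2//; exists z.
Qed.

Lemma synthesis_proj x : F (P x) = F x.
Proof. by have /eqP := synthesis_sub_proj x; rewrite linearB subr_eq0 => /eqP. Qed.

Lemma absop_proj x : A (P x) = A x.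
Proof.
have /absop_eq0/eqP := synthesis_sub_proj x.
by rewrite linearB subr_eq0 => /eqP.
Qed.

Lemma hdot_proj x y : '[x, P y] = '[P x, P y].
Proof. by apply/subr0_eq; rewrite -hdotBl (PF x).2//; exact: (PF y).1. Qed.

Lemma proj_selfadjoint : is_adjoint P P.
Proof. by move=> x y; rewrite hdotC hdot_proj -hdotC -hdot_proj. Qed.

(** [x - P x] lies in the kernel of [F], so it is orthogonal to [x] as well as to [P x], hence to
    itself. *)
Lemma proj_kernel_perp x : (forall y, F y = 0 -> '[x, y] = 0) -> P x = x.
Proof.
move=> xF; apply/esym/subr0_eq/hdotxx_eq0.
rewrite hdotBr ((PF x).2 (P x) (PF x).1).
by rewrite hdotC xF ?synthesis_sub_proj// rmorph0 subr0.
Qed.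

Lemma proj_adjoint h : P (Fs h) = Fs h.
Proof.
by apply: proj_kernel_perp => y Fy; rewrite (adjointC Fa) Fy hdotC hdot0l rmorph0.
Qed.

Lemma proj_idem x : P (P x) = P x.
Proof. by case: (PF x) => -[h _ <-] _; rewrite proj_adjoint. Qed.

Lemma proj_eq0 x : P x = 0 <-> F x = 0.
Proof.
split=> [Px|Fx]; first by rewrite -synthesis_proj Px linear0.
apply: hdotxx_eq0; rewrite -hdot_proj.
by case: (PF x) => -[h _ <-] _; rewrite -Fa Fx hdot0l.
Qed.

Lemma proj_absop x : P (A x) = A x.
Proof.
apply: proj_kernel_perp => y /absop_eq0 Ay.
by rewrite absop_selfadjoint Ay hdotC hdot0l rmorph0.
Qed.

(** [P] and [A] both have the kernel of [F], so a difference fixed by [P] and killed by [A]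
    vanishes. *)
Lemma absop_inj x y : P x = x -> P y = y -> A x = A y -> x = y.
Proof.
move=> Px Py Axy; apply/subr0_eq; rewrite -Px -Py -linearB.
by apply/proj_eq0/absop_eq0; rewrite linearB Axy subrr.
Qed.

Lemma bounded_by_proj : bounded_by P 1.
Proof.
move=> x; rewrite mul1r; have := nrm_ge0 (P x).
rewrite le_eqVlt => /orP[/eqP<-|n0]; first exact: nrm_ge0.
rewrite -(ler_pM2r n0) -expr2 -Re_hdotxx -hdot_proj.
exact: Re_hdot_le.
Qed.

Lemma polar_exists (c : R) : 0 <= c < 1 -> bounded_by (P \- A) c ->
  exists (U : {linear l2 -> H}) (Us : {linear H -> l2}),
    [/\ is_adjoint U Us, forall x, F x = U (A x), forall x, Us (U x) = P x,
        forall y, A (Us y) = Fs y & forall y, P (Us y) = Us y].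
Proof.
move=> c01 Bc.
(* Such a [w] satisfies [P w = w], so the equation reads [A w = P z]: [G] inverts [A] on the range
   of [P]. *)
have /choice[G GE] : forall z, exists w, w = (P w - A w) + P z.
  by move=> z; exact: (contraction_fixed_point (P z) c01 Bc).
have PG z : P (G z) = G z.
  by rewrite [in LHS]GE linearD linearB proj_absop !proj_idem -GE.
have AG z : A (G z) = P z.
  have /eqP := GE z; rewrite PG -addrA eq_sym -subr_eq0 addrAC subrr add0r.
  by rewrite addrC subr_eq0 => /eqP.
have GA z : G (A z) = P z.
  by apply: absop_inj; rewrite ?PG ?proj_idem// AG proj_absop absop_proj.
(* [G] is a pointwise choice; its self-adjointness, read off from [A G = P], is what yields the
   linearity of [F \o G] and [G \o Fs]. *)
have Ga : is_adjoint G G.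
  move=> x y; rewrite -(PG x) proj_selfadjoint -AG -absop_selfadjoint AG.
  by rewrite proj_selfadjoint PG.
have Ua := adjoint_comp Ga Fa.
have Ul := adjoint_linear Ua; have Usl := adjoint_linear (adjointC Ua).
exists (mklinear Ul), (mklinear Usl); split=> //= x.
- by rewrite GA synthesis_proj.
- by have [_ _ AA] := AF; rewrite -AA AG absop_proj GA.
- by rewrite AG proj_adjoint.
Qed.

(** * Operators [U] with [U^* U = P]: partial isometry, closed range and tightness *)

Context (U : {linear l2 -> H}) (Us : {linear H -> l2}).
Context (Ua : is_adjoint U Us) (UsU : forall x, Us (U x) = P x).

Lemma nrm_polar x : nrm (U x) = nrm (P x).
Proof.
apply/eqP; rewrite -(eqrXn2 (_ : 0 < 2)%N) ?nrm_ge0//.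
by rewrite -!Re_hdotxx Ua UsU hdot_proj.
Qed.

Lemma bounded_by_polar : bounded_by U 1.
Proof. by move=> x; rewrite nrm_polar bounded_by_proj. Qed.

Lemma polar_proj x : U (P x) = U x.
Proof.
apply/subr0_eq/nrm0_eq0; rewrite -linearB nrm_polar linearB proj_idem subrr.
by rewrite nrm0.
Qed.

Lemma polar_eq0 x : U x = 0 <-> F x = 0.
Proof.
rewrite -proj_eq0; split=> h; apply: nrm0_eq0.
  by rewrite -nrm_polar h nrm0.
by rewrite nrm_polar h nrm0.
Qed.

Lemma polarP : (forall x, F x = U (A x)) -> is_polar F A U.
Proof.
move=> FU; split=> //.
  move=> x xU; rewrite nrm_polar proj_kernel_perp// => y Fy.
  by apply: xU; apply/polar_eq0.
by apply/seteqP; split=> x /polar_eq0.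
Qed.

(** [U \o Us] is a contraction that fixes the range of [U], so it also fixes every point of the
    closure. *)
Lemma closed_subspace_range_polar : closed_subspace (range U).
Proof.
split; first by exists 0; rewrite ?linear0.
  by move=> a _ _ [x _ <-] [y _ <-]; exists (a *: x + y); rewrite ?linearP.
move=> x xU; exists (Us x) => //; apply/esym/subr0_eq/nrm_le_eq0 => e e0.
have e20 : 0 < (e / 2)%:C :> R[i] by rewrite ltcR divr_gt0.
have [_ [[y _ <-]]] := xU _ (nbhsx_ballx x _ e20).
rewrite -ball_normE/= nrmE ltcR => xy.
rewrite (_ : x - U (Us x) = (x - U y) - U (Us (x - U y))); last first.
  by rewrite [Us (_ - _)]linearB UsU [U (_ - P y)]linearB polar_proj opprB addrA subrK.
apply: le_trans (nrmD _ _) _; rewrite nrmN [leRHS]splitr lerD ?(ltW xy)//.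
apply: le_trans (bounded_by_polar _) _; rewrite mul1r.
apply: le_trans (bounded_adjoint ler01 bounded_by_polar Ua _) _.
by rewrite mul1r ltW.
Qed.

(** The analysis coefficients of [y] are the coordinates of [Ws y]. *)
Lemma sum_sqr_adjoint (W : l2 -> H) (Ws : H -> l2) y : is_adjoint W Ws ->
  (\sum_(0 <= i <oo) (nrm '[y, W (e_ i)] ^+ 2)%:E = (nrm (Ws y) ^+ 2)%:E)%E.
Proof.
move=> Wa; rewrite -nneseries_nrm_sqr; apply: eq_eseriesr => i _.
by rewrite -(adjointC Wa) hdot_basis.
Qed.

Lemma polar_tight : normalized_tight_frame (range U) (fun i => U (e_ i)).
Proof.
split=> [i|_ [x _ <-]]; first by exists (e_ i).
by rewrite (sum_sqr_adjoint _ Ua) UsU nrm_polar mul1r lexx.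
Qed.

End polar_decomposition.

(** * Optimality among weakly similar normalized tight frames *)

Section optimality.
Context (R : realType) (H : hilbertType R).
Local Open Scope complex_scope.
Local Notation l2 := (l2 R).
Local Notation e_ := (l2_basis R).
Context (F : {linear l2 -> H}) (Fs : {linear H -> l2}) (A P : {linear l2 -> l2}).
Context (Fb : bounded_op F) (Fa : is_adjoint F Fs) (AF : is_absop F Fs A).
Context (PF : is_orthoproj (range Fs) P).

(** [W = L \o F] has the kernel of [F] since [L] is injective on [S]. Tightness makes [W^* W]
    idempotent, so it is the orthogonal projection with that kernel, which is [P]. *)
Lemma weakly_similar_synthesis (S T : set H) (f u : nat -> H) :
  closed_subspace S -> (forall i, S (f i)) -> (forall i, F (e_ i) = f i) ->
  closed_subspace T -> normalized_tight_frame T u -> weakly_similar S f T u ->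
  exists (W : {linear l2 -> H}) (Ws : {linear H -> l2}),
    [/\ is_adjoint W Ws, forall i, W (e_ i) = u i & forall x, Ws (W x) = P x].
Proof.
move=> Scl Sf Fe _ [_ Tu] [L [M [[[Ll [c Lc]] [Ml _]] LS MT Lfu]]].
have S0 : S 0 by case: Scl.
have SF x : S (F x).
  by apply: closed_subspace_range => // i; rewrite Fe.
have Wl : linear (L \o F) by move=> a x y /=; rewrite linearP Ll.
pose W := mklinear Wl.
have L0 : L 0 = 0.
  have := Ll 1 0 0 S0 S0.
  by rewrite !scale1r addr0 => /eqP; rewrite -subr_eq subrr => /eqP.
have M0 : M 0 = 0 by have [_] := LS 0 S0; rewrite L0.
have W0 x : W x = 0 <-> F x = 0.
  split=> [Wx|Fx]; last by rewrite -[W x]/(L (F x)) Fx.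
  by have [_ <-] := LS _ (SF x); rewrite -[L _]/(W x) Wx.
have [k k0 Fk] := bounded_byP Fb.
have Wb : bounded_op W.
  (* The constant [c] carries no sign condition, hence its absolute value. *)
  apply: (@bounded_by_bounded_op _ _ _ _ (`|c| * k)); first exact: mulr_ge0.
  move=> x; apply: le_trans (Lc _ (SF x)) _; rewrite -mulrA.
  apply: le_trans (ler_wpM2r (nrm_ge0 _) (ler_norm c)) _.
  by rewrite ler_wpM2l.
have [Ws Wa] := bounded_l2_adjoint Wb.
have Wu i : W (e_ i) = u i by rewrite -Lfu -Fe.
exists W, (mklinear (adjoint_linear (adjointC Wa))); split=> // x /=.
have tight y : T y -> nrm (Ws y) ^+ 2 = nrm y ^+ 2.
  move=> /Tu; rewrite mul1r -eq_le => /eqP h; apply: EFin_inj; rewrite h.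
  by rewrite -(sum_sqr_adjoint y Wa); apply: eq_eseriesr => i _; rewrite Wu.
have Ka : is_adjoint (Ws \o W) (Ws \o W) := adjoint_comp Wa (adjointC Wa).
have Kl := adjoint_linear Ka; pose K := mklinear Kl.
(* Tightness at [W z] says that [K z] and [W z] have equal norms, so the quadratic form of [K^2 - K]
   is zero. *)
have KK z : K (K z) - K z = 0.
  apply: (@quadratic_form_eq0 _ _ (fun z => K (K z) - K z)) => {z} [a y z|z].
    rewrite [K (a *: y + z)]linearP [K (a *: K y + K z)]linearP scalerBr [RHS]addrACA; congr (_ + _); exact: opprD.
  have := @tight (W z) (LS _ (SF z)).1; rewrite hdotBl Ka !hdotxx.
  by rewrite (adjointC Wa) hdotxx => ->; rewrite subrr.
have WK : W (K x - x) = 0.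
  apply: hdotxx_eq0; rewrite Wa -[Ws _]/(K _) linearB KK.
  by rewrite hdotC hdot0l rmorph0.
have PK : P (K x) = K x.
  apply: (proj_kernel_perp Fa PF) => y /W0 Wy.
  by rewrite (adjointC Wa) Wy hdotC hdot0l rmorph0.
(* [K x - P x = P (K x - x)], and [K x - x] lies in the common kernel of [W], [F] and [P]. *)
apply/subr0_eq; rewrite -[Ws _]/(K x) -PK -linearB.
exact/(proj_eq0 Fa PF)/W0.
Qed.

Context (U : {linear l2 -> H}) (Us : {linear H -> l2}).
Context (Ua : is_adjoint U Us) (UsU : forall x, Us (U x) = P x).
Context (FU : forall x, F x = U (A x)).
Context (Bh : hilbert_schmidt (P \- A)) (B1 : bounded_by (P \- A) 1).

Lemma polar_sub x : U ((P \- A) x) = U x - F x.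
Proof. by rewrite linearB (polar_proj Fa PF Ua UsU) FU. Qed.

Lemma polar_sqdist_lty : (sqdist (fun i => U (e_ i)) (fun i => F (e_ i)) < +oo)%E.
Proof.
have [UBh _] := hilbert_schmidt_comp ler01 (bounded_by_polar PF Ua UsU) Bh.
rewrite /sqdist (eq_eseriesr (g := fun i => (nrm ((U \o (P \- A)) (e_ i)) ^+ 2)%:E))//.
by move=> i _; rewrite /= -polar_sub.
Qed.

Lemma polar_sqdist_le (W : {linear l2 -> H}) (Ws : {linear H -> l2}) :
  is_adjoint W Ws -> (forall x, Ws (W x) = P x) ->
  (sqdist (fun i => U (e_ i)) (fun i => F (e_ i)) <=
   sqdist (fun i => W (e_ i)) (fun i => F (e_ i)))%E.
Proof.
move=> Wa WsW; pose B : {linear l2 -> l2} := P \- A.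
have W1 : bounded_by W 1.
  move=> x; rewrite mul1r -(ler_pXn2r (_ : 0 < 2)%N) ?nnegrE ?nrm_ge0//.
  rewrite -Re_hdotxx Wa WsW (hdot_proj PF) Re_hdotxx.
  rewrite ler_pXn2r ?nnegrE ?nrm_ge0//.
  by have := bounded_by_proj PF x; rewrite mul1r.
have U1 := bounded_by_polar PF Ua UsU.
have [UBh _] := hilbert_schmidt_comp ler01 U1 Bh.
(* An infinite distance for [W] is trivial; otherwise [W - F] is Hilbert-Schmidt, and so is [Y], its
   difference with [U B]. *)
have [->|Doo] := eqVneq (sqdist (fun i => W (e_ i)) (fun i => F (e_ i))) +oo%E.
  exact: leey.
pose D x := W x - F x.
have Dh : hilbert_schmidt D by rewrite /hilbert_schmidt ltey.
pose Y x := W x - U x; pose Ys y := Ws y - Us y.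
have Ya : is_adjoint Y Ys.
  by move=> x y; rewrite hdotBl hdotBr Wa Ua.
have YD : Y = (fun x => D x + - (U \o B) x).
  by apply/funext => x; rewrite /= polar_sub /Y /D opprB addrC addrA subrK addrC.
have Yh : hilbert_schmidt Y.
  by rewrite YD; exact: hilbert_schmidtD (hilbert_schmidtN _).
have Y2 : bounded_by Y 2.
  move=> x; apply: le_trans (nrmD _ _) _; rewrite nrmN mulr_natl mulr2n.
  by rewrite lerD// -[leRHS]mul1r.
have DY : D = (fun x => Y x + (U \o B) x).
  by rewrite YD; apply/funext => x; rewrite addrNK.
have Ba : is_adjoint B B.
  by move=> x y; rewrite hdotBl hdotBr (proj_selfadjoint PF) (absop_selfadjoint AF).
have X1 : bounded_by Us 1 := bounded_adjoint ler01 U1 Ua.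
have [Xh _] := hilbert_schmidt_comp ler01 X1 Yh.
have Xa : is_adjoint (Us \o Y) (Ys \o U) := adjoint_comp Ya (adjointC Ua).
have [Xsh _] := hilbert_schmidt_adjoint Xa Xh.
have YBh := (hilbert_schmidt_comp (ler0n R 2) Y2 Bh).1.
(* Moving [U] across gives operators from [l2] to itself, where [hs_dot_adjoint] applies. *)
have dotE : hs_dot Y (U \o B) = hs_dot (Us \o Y) B.
  congr (limn (series _)); apply/funext => i.
  rewrite -[RHS]/(complex.Re '[Us (Y (e_ i)), B (e_ i)]).
  by rewrite (adjointC Ua).
(* One of the two copies is replaced by its adjoint version, so that [U^* Y + Y^* U] appears; it
   equals [- Y^* Y] because [W^* W = U^* U = P]. *)
have dot2E : 2 * hs_dot Y (U \o B) = - hs_dot Y (Y \o B).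
  rewrite dotE mulr_natl mulr2n -[in X in _ + X](hs_dot_adjoint Xa Ba Xh Bh).
  rewrite -hs_dotDl// -hs_dotNr//; congr (limn (series _)); apply/funext => i.
  rewrite -[LHS]/(complex.Re '[Us (Y (e_ i)) + Ys (U (e_ i)), B (e_ i)]).
  rewrite -[RHS]/(complex.Re '[Y (e_ i), - Y (B (e_ i))]).
  rewrite hdotNr -(adjointC Ya) -hdotNl; congr (complex.Re '[_, _]).
  by rewrite /Ys /Y [Us (_ - _)]linearB [Ws (_ - _)]linearB UsU WsW !opprB.
have YB := hs_sqr_comp_le (ler0n R 2) Y2 Ya Yh B1 Ba Bh.
(* [2 * hs_dot Y (Y \o B) <= hs_sqr Y + hs_sqr (Y \o B) <= 2 * hs_sqr Y], so the cross term in the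
   expansion of [D = Y + U B] is at least [- hs_sqr Y]. *)
have := hs_dot_le Yh YBh; have := hs_sqrD Yh UBh; rewrite -DY => DE dl.
have -> : sqdist (fun i => U (e_ i)) (fun i => F (e_ i)) = (hs_sqr (U \o B))%:E.
  rewrite -(hs_sqrE UBh); apply: eq_eseriesr => i _.
  by rewrite /= polar_sub.
have -> : sqdist (fun i => W (e_ i)) (fun i => F (e_ i)) = (hs_sqr D)%:E.
  by rewrite -(hs_sqrE Dh).
by rewrite lee_fin; lra.
Qed.

End optimality.

(** * Convergence of the iteration to the adjoint of [U] *)

Lemma affine_iteration_cvg (R : realType) (H E : hilbertType R)
    (B : {linear E -> E}) (Y Z : {linear H -> E}) (c : R) :
  0 <= c < 1 -> bounded_by B c -> bounded_op Z ->
  (forall y, Z y = B (Z y) + Y y) ->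
  forall X : nat -> {linear H -> E}, bounded_op (X 0%N) ->
    (forall n x, X n.+1 x = B (X n x) + Y x) ->
    opnorm (X n \- Z) @[n --> \oo] --> 0%E.
Proof.
move=> c01 Bc Zb ZE X X0b XE; have /andP[c0 c1] := c01.
have [k0 k00 X0k] := bounded_byP X0b; have [k k_0 Zk] := bounded_byP Zb.
(* The error satisfies the homogeneous recursion with [B], and the initial error is bounded by
   [k0 + k]. *)
have XZ n : bounded_by (X n \- Z) (c ^+ n * (k0 + k)).
  elim: n => [|n IH] x.
    rewrite mul1r mulrDl; apply: le_trans (nrmD _ _) _.
    by rewrite nrmN lerD.
  rewrite /= XE ZE opprD addrACA subrr addr0 -linearB exprS -!mulrA.
  by apply: le_trans (Bc _) _; rewrite ler_wpM2l// mulrA; exact: IH.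
apply: (@squeeze_cvge _ _ _ _ (cst 0%E) _ (fun n => (c ^+ n * (k0 + k))%:E)).
- apply: nearW => n /=; apply/andP; split; first exact: opnorm_ge0.
  by apply: bounded_by_opnorm; rewrite ?mulr_ge0 ?exprn_ge0 ?addr_ge0.
- exact: cvg_cst.
apply: cvg_EFin; first exact: nearW.
rewrite -[X in _ --> X](mul0r (k0 + k)); apply: cvgM; last exact: cvg_cst.
by apply: cvg_expr; rewrite ger0_norm.
Qed.

Theorem proposition6p17 (R : realType) (H : hilbertType R)
    (S : set H) (f : nat -> H)
    (F : {linear l2 R -> H}) (Fs : {linear H -> l2 R})
    (absF P V : {linear l2 R -> l2 R}) :
  closed_subspace S -> frame S f ->
  is_synthesis f F -> is_adjoint F Fs ->
  is_absop F Fs absF -> is_orthoproj (range Fs) P ->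
  (forall x, absF x = P x - V x) ->
  hilbert_schmidt (P \- absF) -> (opnorm (P \- absF)%R < 1)%E ->
  exists (v : nat -> H) (U : {linear l2 R -> H}) (Us : {linear H -> l2 R}),
    [/\ symmetric_approximation S f v,
        is_polar F absF U,
        is_synthesis v U,
        is_adjoint U Us
      & forall X : nat -> {linear H -> l2 R},
          bounded_op (X 0%N) ->
          (forall n x, X n.+1 x = (P \- absF) (X n x) + Fs x) ->
          opnorm (X n \- Us) @[n --> \oo] --> 0%E].
Proof.
move=> Scl [a [b [a0 b0 [Sf _]]]] [Fb Fe] Fa AF PF _ Bh B1.
have Bb : bounded_op (P \- absF) by apply: lt_trans B1 _; rewrite ltry.
have [c0 Bc] := opnorm_bounded_by Bb.
set c := fine _ in c0 Bc.
have c1 : c < 1.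
  by rewrite -lte_fin /c fineK// ge0_fin_numE// opnorm_ge0.
have c01 : 0 <= c < 1 by rewrite c0.
have B1' : bounded_by (P \- absF) 1.
  by move=> x; apply: le_trans (Bc x) _; rewrite ler_wpM2r ?nrm_ge0// ltW.
have [U [Us [Ua FU UsU AUs PUs]]] := polar_exists Fa AF PF c01 Bc.
have fE : f = (fun i => F (l2_basis R i)) by apply/funext => i; rewrite Fe.
have U1 := bounded_by_polar PF Ua UsU.
exists (fun i => U (l2_basis R i)), U, Us; split=> //.
- split.
  + exists (range U); first exact: (closed_subspace_range_polar Fa PF Ua UsU).
    exact: (polar_tight PF Ua UsU).
  + move=> T u Tcl Tu fu.
    have [W [Ws [Wa Wu WsW]]] :=
      weakly_similar_synthesis Fb Fa PF Scl Sf Fe Tcl Tu fu.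
    have -> : u = (fun i => W (l2_basis R i)) by apply/funext => i; rewrite Wu.
    rewrite fE.
    exact: (polar_sqdist_le Fa AF PF Ua UsU FU Bh B1' Wa WsW).
  + by rewrite fE; exact: (polar_sqdist_lty Fa PF Ua UsU FU Bh).
- exact: (polarP Fa PF Ua UsU FU).
- by split=> //; exact: bounded_by_bounded_op U1.
apply: (affine_iteration_cvg c01 Bc) => [|y].
  apply: (@bounded_by_bounded_op _ _ _ _ 1) => //.
  exact: bounded_adjoint ler01 U1 Ua.
(* [Us] is the fixed point: [(P - |F|) Us + Fs = Us - Fs + Fs]. *)
by rewrite /= AUs PUs subrK.
Qed.
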